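(* Let $\gamma$ and $\delta$ be diagrams with $\gamma\subset\delta$. Then \[ \widetilde H_{\delta}(X;0,t)=\sum_{\lambda\vdash|\delta|}\ \sum_{\substack{w\in\mathrm{Yam}_\delta(\lambda)\\ \mathrm{inv}_\delta(w)=0}} t^{\mathrm{maj}_\delta(w)}\,s_\lambda, \qquad R_{\gamma,\delta}(X)=\sum_{\lambda\vdash|\delta|}\ \sum_{\substack{w\in\mathrm{Yam}_\delta(\lambda)\\ \mathrm{inv}_\delta(w)=0,\ \mathrm{Descent}_\delta(w)=\gamma}} s_\lambda , \] where $s_\lambda$ denotes the Schur function.
   Context: A diagram is a finite subset $\delta\subset\mathbb Z\times\mathbb Z$; its elements $(x,y)$ are cells ($x$ = column, $y$ = row), and $|\delta|$ is its number of cells. Row reading order: rows from top (largest $y$) to bottom, each row read left to right (increasing $x$). A filling of $\delta$ is a map from $\delta$ to positive integers; it is standard if it is a bijection onto $[n]=\{1,\dots,n\}$, $n=|\delta|$; $\mathrm{SF}(\delta)$ is the set of standard fillings. The row reading word $\mathrm{rw}(T)$ lists the values of $T$ in row reading order; for a word $w$ of length $|\delta|$, $T_\delta(w)$ is the filling of $\delta$ with $\mathrm{rw}(T_\delta(w))=w$. Pistols: for a cell $c=(x,y)\in\delta$, the pistol starting at $c$ is the set of cells of $\delta$ lying, in row reading order, weakly after $c$ and weakly before the position $(x,y-1)$ (i.e. the cells $(x',y)\in\delta$ with $x'\ge x$ together with the cells $(x',y-1)\in\delta$ with $x'\le x$). Numbering the cells $1,\dots,n$ in row reading order, a set of indices is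 $\delta$-pistoled if the corresponding cells all lie in one pistol. A Yamanouchi word of content $\lambda$ (a partition) is a word $w$ in which each $i$ occurs exactly $\lambda_i$ times and such that, reading from right to left, at every point the number of $i+1$'s read never exceeds the number of $i$'s read; $\mathrm{Yam}(\lambda)$ is the set of these. A Yamanouchi word $w$ of length $|\delta|$ jams $\delta$ if there exist $i,j$ such that the position of the $j$-th from last occurrence of $i$ in $w$ and the position of the $(j+1)$-th from last occurrence of $i+1$ in $w$ form a $\delta$-pistoled set. $\mathrm{Yam}_\delta(\lambda)=\{w\in\mathrm{Yam}(\lambda): w \text{ does not jam }\delta\}$. Statistics for a filling $T$ of $\delta$: a descent is a cell $c=(x,y)\in\delta$ with $(x,y-1)\in\delta$ and $T(c)>T(x,y-1)$; $\mathrm{Descent}(T)$ is the set of descents. $\mathrm{leg}(c)$ is the number of cells of $\delta$ strictly above $c$ in its column; $\mathrm{maj}(T)=\sum_{c\in\mathrm{Descent}(T)}(1+\mathrm{leg}(c))$. For positions $c=(x,y)$, $d=(x',y)$ with $x'>x$, and $e=(x,y-1)$, with $d\in\delta$: if $c,d,e\in\delta$ they form an inversion triple when $T(e)<T(d)<T(c)$, or $T(c)\le T(e)<T(d)$, or $T(d)<T(c)\le T(e)$; if $c\notin\delta$ but $d,e\in\delta$, then $\{d,e\}$ is an inversion pair when $T(d)>T(e)$; if $e\notin\delta$ but $c,d\in\delta$, then $\{c,d\}$ is an inversion pair when $T(c)>T(d)$. $\mathrm{inv}(T)$ is the number of inversion triples plus inversion pairs. For a word $w$ of length $|\delta|$,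 $\mathrm{inv}_\delta(w)=\mathrm{inv}(T_\delta(w))$, $\mathrm{maj}_\delta(w)=\mathrm{maj}(T_\delta(w))$, $\mathrm{Descent}_\delta(w)=\mathrm{Descent}(T_\delta(w))$. For $\pi\in S_n$ in one-line notation, its signature $\sigma(\pi)\in\{\pm1\}^{n-1}$ has $\sigma_i=+1$ iff $i$ appears before $i+1$ in $\pi$; $\sigma(T)=\sigma(\mathrm{rw}(T))$ for standard $T$. The fundamental quasisymmetric function is $F_\sigma(X)=\sum x_{i_1}\cdots x_{i_n}$ over $i_1\le\dots\le i_n$ with $i_j=i_{j+1}\Rightarrow\sigma_j=+1$. Define $\widetilde H_\delta(X;0,t)=\sum_{T\in\mathrm{SF}(\delta),\ \mathrm{inv}(T)=0} t^{\mathrm{maj}(T)}F_{\sigma(T)}$ and, for $\gamma\subset\delta$, $R_{\gamma,\delta}(X)=\sum_{T\in\mathrm{SF}(\delta),\ \mathrm{inv}(T)=0,\ \mathrm{Descent}(T)=\gamma} F_{\sigma(T)}$. *)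

(* Defs.v *)
From mathcomp Require Import all_boot all_order all_algebra.
From mathcomp Require Import finmap.
From mathcomp.multinomials Require Import monalg.

Set Implicit Arguments.
Unset Strict Implicit.
Unset Printing Implicit Defensive.

Import Order.TTheory GRing.Theory Num.Theory.

Local Open Scope fset_scope.

(* All words of length at most n with letters at most n: a finite universe in
   which the sets of partitions and words below are carved out.  That nothing
   is lost by this bound is [mem_partitions] and [mem_Yam]. *)
Definition words (n : nat) : {fset seq nat} :=
  [fset map val (val b) | b in {: {bseq n of 'I_n.+1}}].

Lemma mem_words n w :
  (w \in words n) = (size w <= n) && all (leq^~ n) w.
Proof.
apply/imfsetP/andP => [[b _ ->] | [szw /allP wn]].
  split; first by rewrite size_map size_bseq.
  by apply/allP => _ /mapP [i _ ->]; rewrite -ltnS ltn_ord.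
have szi : size (map (@inord n) w) <= n by rewrite size_map.
exists (Bseq szi) => //=.
by rewrite -map_comp -[LHS]map_id; apply/eq_in_map => i /wn /= ?; rewrite inordK.
Qed.

(* Formal power series in variables indexed by [nat] (only the order of the
   index set matters, so x_{i+1} is the variable of index i), given by their
   coefficients. *)
Definition series (R : Type) := {cmonom nat} -> R.

Definition monom (s : seq nat) : {cmonom nat} := \big[mmul/mone]_(i <- s) ucm i.

Lemma monomE s i : monom s i = count_mem i s.
Proof.
rewrite /monom; elim: s => [|j s IHs]; first by rewrite big_nil cm1.
by rewrite big_cons cmM IHs cmU /=.
Qed.

Lemma monom_supp s : {subset s <= finsupp (monom s)}.
Proof. by move=> i si; rewrite mem_finsupp monomE -lt0n -has_count has_pred1. Qed.

(* The coefficient of m is the number of sequences i_1 <= ... <= i_n that are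
   compatible with sg and have product m; by [monom_supp], their entries lie
   in the support of m.  Signs are booleans, [true] for +1, and sg is indexed
   from 0. *)
Definition fundamental (n : nat) (sg : seq bool) : series int := fun m =>
  #|[set s : n.-tuple (finsupp m) |
     let i j := nth 0 (map val s) j in
     [&& sorted leq (map val s),
         all (fun j => (i j == i j.+1) ==> nth false sg j) (iota 0 n.-1)
       & monom (map val s) == m]]|.

Definition is_partition (la : seq nat) := sorted geq la && (0 \notin la).

Definition partitions (n : nat) : {fset seq nat} :=
  [fset la in words n | is_partition la && (sumn la == n)].

Lemma mem_partitions n la :
  (la \in partitions n) = is_partition la && (sumn la == n).
Proof.
rewrite !inE /= mem_words; apply: andb_idl => /andP[/andP[_ la0] /eqP <-].
elim: la la0 => //= k la IHla; rewrite inE negb_or eq_sym -lt0n.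
case/andP=> k_gt0 /IHla /andP[szla /allP lela].
rewrite leq_addr /= -add1n leq_add //=; apply/allP => i /lela lei.
exact: leq_trans lei (leq_addl _ _).
Qed.

(* Cells (row, column), both numbered from 0. *)
Definition young (la : seq nat) : {fset nat * nat} :=
  [fset p in [seq (r, c) | r <- iota 0 (size la), c <- iota 0 (nth 0 la r)]].

Lemma mem_young la r c : ((r, c) \in young la) = (c < nth 0 la r).
Proof.
rewrite !inE /=; apply/allpairsPdep/idP => [[r' [c' [_ + [-> ->]]]] | ltc].
  by rewrite mem_iota.
exists r, c; rewrite !mem_iota /= ltc; split=> //.
by apply: contraLR ltc; rewrite -!leqNgt => ?; rewrite nth_default.
Qed.

Definition semistandard la (A : {fset nat}) (T : {ffun young la -> A}) : bool :=
  [forall p : young la, forall q : young la,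
     [&& ((val p).1 == (val q).1) && ((val p).2 <= (val q).2) ==>
           (val (T p) <= val (T q))
       & ((val p).2 == (val q).2) && ((val p).1 < (val q).1) ==>
           (val (T p) < val (T q))]].

(* Generating function of semistandard tableaux; the tableaux contributing to
   the coefficient of m have all their entries in the support of m. *)
Definition schur (la : seq nat) : series int := fun m =>
  #|[set T : {ffun young la -> finsupp m} |
     semistandard T && (monom [seq val (T p) | p : young la] == m)]|.

(* (x, y) is column x, row y. *)
Notation cell := (int * int)%type.
Notation diagram := {fset cell}.

Definition below (c : cell) : cell := (c.1, c.2 - 1)%R.
Definition above (c : cell) : cell := (c.1, c.2 + 1)%R.

Definition row_reading (c d : cell) : bool :=
  (d.2 < c.2)%R || (c.2 == d.2) && (c.1 <= d.1)%R.

Definition reading (delta : diagram) : seq cell := sort row_reading delta.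

Lemma row_reading_total : total row_reading.
Proof.
move=> [x y] [x' y']; rewrite /row_reading /=.
by case: (ltgtP y y') => //= _; exact: le_total.
Qed.

Lemma row_reading_trans : transitive row_reading.
Proof.
move=> [x2 y2] [x1 y1] [x3 y3]; rewrite /row_reading /=.
case/orP=> [lt21 | /andP[/eqP -> le12]] /orP[lt32 | /andP[/eqP <- le23]].
- by rewrite (lt_trans lt32 lt21).
- by rewrite lt21.
- by rewrite lt32.
- by rewrite eqxx (le_trans le12 le23) orbT.
Qed.

Lemma row_reading_anti : antisymmetric row_reading.
Proof.
move=> [x y] [x' y']; rewrite /row_reading /=.
by case: (ltgtP y y') => //= -> /le_anti ->.
Qed.

Lemma reading_sorted delta : sorted row_reading (reading delta).
Proof. exact/sort_sorted/row_reading_total. Qed.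

Lemma mem_reading delta : reading delta =i delta.
Proof. by move=> c; rewrite mem_sort. Qed.

Lemma reading_uniq delta : uniq (reading delta).
Proof. by rewrite sort_uniq fset_uniq. Qed.

Lemma size_reading delta : size (reading delta) = #|` delta|.
Proof. by rewrite size_sort. Qed.

Definition filling (delta : diagram) := {ffun delta -> nat}.

(* The value at a position that may lie outside the diagram, where it is 0. *)
Definition val_at delta (T : filling delta) (c : cell) : nat :=
  oapp T 0 (insub c).

Lemma val_atE delta (T : filling delta) (c : delta) : val_at T (val c) = T c.
Proof. by rewrite /val_at valK. Qed.

Definition standard delta (T : filling delta) : bool :=
  perm_eq (codom T) (iota 1 #|` delta|).

Definition SF (delta : diagram) : {fset filling delta} :=
  let bounded := {ffun delta -> 'I_#|` delta|.+1} in
  [fset T in [fset [ffun c => val (f c)] | f : bounded in {: bounded}] | standard T].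

Lemma mem_SF delta (T : filling delta) : (T \in SF delta) = standard T.
Proof.
rewrite !inE /=; apply/andb_idl => Tstd; apply/imfsetP => /=.
exists [ffun c => inord (T c)] => //; apply/ffunP => c; rewrite !ffunE inordK //.
have: T c \in codom T by exact: codom_f.
by rewrite (perm_mem Tstd) mem_iota add1n => /andP[].
Qed.

Definition rw delta (T : filling delta) : seq nat := map (val_at T) (reading delta).

Definition fill (delta : diagram) (w : seq nat) : filling delta :=
  [ffun c => nth 0 w (index (val c) (reading delta))].

Lemma rw_fill delta w : size w = #|` delta| -> rw (fill delta w) = w.
Proof.
move=> szw; have szr := size_reading delta.
apply: (@eq_from_nth _ 0) => [|i]; rewrite size_map ?szr // => ltir.
have c0 : cell := (0, 0)%R.
have inr : nth c0 (reading delta) i \in delta by rewrite -mem_reading mem_nth ?szr.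
rewrite (nth_map c0) ?szr // -[nth c0 _ i]/(val [` inr]) val_atE ffunE /=.
by rewrite index_uniq ?szr ?reading_uniq.
Qed.

Definition Descent delta (T : filling delta) : diagram :=
  [fset c in delta | (below c \in delta) && (val_at T (below c) < val_at T c)].

Definition leg (delta : diagram) (c : cell) : nat :=
  #|` [fset d in delta | (d.1 == c.1) && (c.2 < d.2)%R]|.

Definition maj delta (T : filling delta) : nat :=
  \sum_(c <- Descent T) (1 + leg delta c).

(* p is the pair (c, d) of cells of one row, c left of d; the third cell is
   e = below c. *)
Definition inv_triples delta (T : filling delta) : {fset cell * cell} :=
  [fset p in delta `*` delta |
    let c := p.1 in let d := p.2 in let e := below c in
    [&& c.2 == d.2, (c.1 < d.1)%R, e \in delta &
        let Tc := val_at T c in let Td := val_at T d in let Te := val_at T e in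
        [|| Te < Td < Tc, Tc <= Te < Td | Td < Tc <= Te]]].

(* p is the pair (d, e) with e in the row below d, strictly to its left. *)
Definition inv_pairs_de delta (T : filling delta) : {fset cell * cell} :=
  [fset p in delta `*` delta |
    let d := p.1 in let e := p.2 in
    [&& (above e).2 == d.2, ((above e).1 < d.1)%R, above e \notin delta &
        val_at T e < val_at T d]].

(* p is the pair (c, d) of cells of one row, c left of d. *)
Definition inv_pairs_cd delta (T : filling delta) : {fset cell * cell} :=
  [fset p in delta `*` delta |
    let c := p.1 in let d := p.2 in
    [&& c.2 == d.2, (c.1 < d.1)%R, below c \notin delta &
        val_at T d < val_at T c]].

Definition inv delta (T : filling delta) : nat :=
  #|` inv_triples T| + (#|` inv_pairs_de T| + #|` inv_pairs_cd T|).

Definition inv_word (delta : diagram) (w : seq nat) := inv (fill delta w).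
Definition maj_word (delta : diagram) (w : seq nat) := maj (fill delta w).
Definition Descent_word (delta : diagram) (w : seq nat) := Descent (fill delta w).

(* Positions, in words and in the reading order, are numbered from 0. *)
Definition pistol (delta : diagram) (c : cell) : {fset cell} :=
  [fset d in delta | row_reading c d && row_reading d (below c)].

Definition pistoled (delta : diagram) (I : seq nat) : bool :=
  [exists c : delta, all (fun k =>
     (k < #|` delta|) && (nth (0, 0)%R (reading delta) k \in pistol delta (val c))) I].

Definition yamanouchi (la w : seq nat) : bool :=
  [&& all (fun i => 0 < i <= size la) w,
      all (fun i => count_mem i w == nth 0 la i.-1) (iota 1 (size la))
    & all (fun k => all (fun i => count_mem i.+1 (drop k w) <= count_mem i (drop k w))
                        (iota 1 (size la)))
          (iota 0 (size w))].

Lemma yamanouchiP la w :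
  reflect [/\ 0 \notin w,
              forall i, 0 < i -> count_mem i w = nth 0 la i.-1
            & forall k i, 0 < i ->
                count_mem i.+1 (drop k w) <= count_mem i (drop k w)]
          (yamanouchi la w).
Proof.
apply: (iffP and3P) => [[/allP w_in /allP w_la /allP w_yam] | [w0 w_la w_yam]].
  have cnt0 i : size la < i -> count_mem i w = 0.
    move=> lti; apply/count_memPn; apply: contraTN lti => /w_in /andP[_].
    by rewrite -leqNgt.
  split=> [|i i_gt0 | k i i_gt0].
  - by apply/negP => /w_in.
  - have [ltis | lesi] := ltnP (size la) i.
      by rewrite cnt0 // nth_default // -ltnS prednK.
    by apply/eqP/w_la; rewrite mem_iota i_gt0 add1n ltnS.
  have [ltkw | lewk] := ltnP k (size w); last by rewrite drop_oversize.
  have [ltis | lesi] := ltnP (size la) i.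
    suff -> : count_mem i.+1 (drop k w) = 0 by [].
    apply/eqP; rewrite -leqn0 -(cnt0 i.+1) ?leqW //.
    by rewrite -{2}(cat_take_drop k w) count_cat leq_addl.
  have /w_yam/allP : k \in iota 0 (size w) by rewrite mem_iota.
  by apply; rewrite mem_iota i_gt0 add1n ltnS.
split; apply/allP.
- move=> i wi; have i_gt0 : 0 < i by case: i wi w0 => // ->.
  rewrite i_gt0 -(prednK i_gt0) ltnNge; apply/negP => lesi.
  have := w_la i i_gt0; rewrite nth_default // => /eqP; rewrite -leqn0 leqNgt.
  by rewrite -has_count has_pred1 wi.
- by move=> i; rewrite mem_iota => /andP[i_gt0 _]; rewrite w_la.
by move=> k _; apply/allP => i; rewrite mem_iota => /andP[i_gt0 _]; exact: w_yam.
Qed.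

Lemma size_yamanouchi la w : yamanouchi la w -> size w = sumn la.
Proof.
case/and3P => /allP w_in /allP w_la _.
transitivity (\sum_(i <- iota 1 (size la)) count_mem i w).
  elim: w w_in {w_la} => [|j w IHw] w_in; first by rewrite big1.
  rewrite /= big_split /= -IHw => [|i wi]; last by rewrite w_in // inE wi orbT.
  have j_in : j \in iota 1 (size la).
    by rewrite mem_iota add1n ltnS w_in // mem_head.
  rewrite (bigD1_seq j) ?iota_uniq //= eqxx big1 // => i ne_ij.
  by rewrite eq_sym (negPf ne_ij).
rewrite sumnE [RHS](big_nth 0) /index_iota subn0.
have -> : iota 1 (size la) = map S (iota 0 (size la)) by rewrite -(iotaDl 1 0).
rewrite big_map.
rewrite !big_seq; apply: eq_bigr => i; rewrite mem_iota => lti.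
by apply/eqP; rewrite w_la // mem_iota add1n.
Qed.

(* p is the position of the j-th from last occurrence of i in w, j >= 1. *)
Definition from_last (w : seq nat) (i j p : nat) : bool :=
  [&& p < size w, nth 0 w p == i & count_mem i (drop p w) == j].

Definition jams (delta : diagram) (w : seq nat) : bool :=
  [exists p : 'I_(size w), exists q : 'I_(size w),
     [&& from_last w (nth 0 w p).+1 (count_mem (nth 0 w p) (drop p w)).+1 q
       & pistoled delta [:: val p; val q]]].

Lemma jamsP delta w :
  reflect (exists i j p q, [/\ from_last w i j p, from_last w i.+1 j.+1 q
                             & pistoled delta [:: p; q]])
          (jams delta w).
Proof.
apply: (iffP existsP) => [[p /existsP[q /andP[wq pq]]] | ].
  exists (nth 0 w p), (count_mem (nth 0 w p) (drop p w)), p, q.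
  by split=> //; rewrite /from_last ltn_ord !eqxx.
move=> [i [j [p [q [/and3P[ltp /eqP wp /eqP cp] wq pq]]]]].
have ltq : q < size w by case/and3P: wq.
exists (Ordinal ltp); apply/existsP; exists (Ordinal ltq) => /=.
by rewrite wp cp wq.
Qed.

Definition Yam (la : seq nat) : {fset seq nat} :=
  [fset w in words (sumn la) | yamanouchi la w].

Lemma mem_Yam la w : is_partition la -> (w \in Yam la) = yamanouchi la w.
Proof.
move=> /andP[_ la0]; rewrite !inE /= mem_words; apply: andb_idl => yw.
rewrite (size_yamanouchi yw) leqnn /=; apply/allP => i.
case/and3P: yw => /allP w_in _ _ /w_in /andP[_ /= lei]; apply: leq_trans lei _.
elim: la la0 {w_in} => //= k la IHla; rewrite inE negb_or eq_sym -lt0n.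
by case/andP=> k_gt0 /IHla; rewrite -add1n; exact: leq_add.
Qed.

Definition Yam_diag (delta : diagram) (la : seq nat) : {fset seq nat} :=
  [fset w in Yam la | ~~ jams delta w].

Definition signature (pi : seq nat) : seq bool :=
  [seq index i pi < index i.+1 pi | i <- iota 1 (size pi).-1].

Definition Fund delta (T : filling delta) : series int :=
  fundamental #|` delta| (signature (rw T)).

(* The coefficients are polynomials in t = 'X. *)
Definition Htilde (delta : diagram) : series {poly int} := fun m =>
  (\sum_(T <- SF delta | inv T == 0%N) 'X^(maj T) * (Fund T m)%:P)%R.

Definition Rseries (gamma delta : diagram) : series int := fun m =>
  (\sum_(T <- SF delta | (inv T == 0%N) && (Descent T == gamma)) Fund T m)%R.

(* Main.v *)
(** The standard fillings without inversions, weighted by fundamental functions,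
    count arbitrary fillings without inversions by content: standardizing a
    filling (equal entries increase in reading order) changes neither its
    inversions nor its descents.

    Only the numbers of i's and i+1's in each row matter for the crystal
    operators on the word obtained by sorting every row.  When such an operator
    turns an i of row y into i+1, the filling without inversions can be adapted
    by changing a single cell, namely the rightmost i of that row; as the row
    above has fewer i+1's than row y has i's, and row y at least as many i+1's as
    the row below has i's, no inversion and no descent is created or destroyed.
    So the fillings of delta without inversions and with descent set gamma form a
    crystal.

    Stembridge's sign-reversing involution then gives the alternating sum
    sum_s sgn(s) N(s(lambda + rho) - rho) of the numbers N of fillings of given
    content as the number of highest weight fillings of content lambda, and N,
    being symmetric, is determined by these sums.  Semistandard tableaux are
    the fillings of a Young diagram without inversions all of whose cells
    outside the bottom row are descents, with a single highest weight filling;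
    comparison yields the Schur expansion.  Finally a filling without
    inversions has highest weight if and only if its reading word is Yamanouchi
    and does not jam delta: an i+1 and an i of one row that match each other
    would be an inversion unless an i lies below that i+1, and that i jams. *)

From mathcomp.multinomials Require Import monalg.
From mathcomp Require Import all_boot all_order all_algebra.
From mathcomp Require Import fingroup perm zify ring finmap.
Require Import Defs.

Set Implicit Arguments.
Unset Strict Implicit.
Unset Printing Implicit Defensive.

Import Order.TTheory GRing.Theory Num.Theory.

(** * Crystals of row counts *)

Lemma eq_card_bij (S T : finType) (A : {pred S}) (B : {pred T}) (f : S -> T) (g : T -> S) :
  {in A, forall x, f x \in B /\ g (f x) = x} ->
  {in B, forall y, g y \in A /\ f (g y) = y} -> #|A| = #|B|.
Proof.
move=> fP gP; rewrite -(card_in_imset (f := f) (D := A)); last first.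
  by apply: (can_in_inj (g := g)) => x /fP[].
apply: eq_card => y; apply/imsetP/idP => [[x /fP[fx _] ->] // | By].
by exists (g y); have [] := gP y By.
Qed.

(** An increasing permutation moves no element down, and its inverse is increasing as well. *)
Lemma perm_homo_ltn n (s : 'S_n) : {homo s : i j / i < j} -> s = 1%g.
Proof.
have le_s (t : 'S_n) : {homo t : i j / i < j} -> forall i : 'I_n, i <= t i.
  move=> ht [i ltin]; elim: i ltin => // i IHi ltin.
  by apply: leq_ltn_trans (IHi (ltnW ltin)) (ht _ _ _) => /=.
move=> hs; apply/permP => i; rewrite perm1; apply/eqP; rewrite -val_eqE eqn_leq le_s // andbT.
rewrite -{2}(permK s i); apply: le_s => j l jl.
by case: (ltngtP (s^-1 j)%g (s^-1 l)%g) => // [/hs|/val_inj/perm_inj e];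
  rewrite ?permKV ?e; move: jl; rewrite ?e ?ltnn; lia.
Qed.

Section Crystal.

Variables (X : finType) (P : pred X) (k h : nat) (cnt : X -> nat -> nat -> nat).

Definition cum x j y := \sum_(r < y) cnt x r j.

Definition wt x j := cum x j h.

(** In the word with sorted rows, read from right to left, each row yields its [i+1] before its [i];
    so this is the largest surplus of [i+1] over [i] met while reading row [y]. *)
Definition excess i x y : int := ((cum x i.+1 y.+1)%:Z - (cum x i y)%:Z)%R.

Definition prev_cnt x j y := if y is r.+1 then cnt x r j else 0.

(** One [i] of row [y] becomes [i+1]; indicators on both sides avoid truncated subtraction. *)
Definition moved i y x x' := forall r j,
  cnt x' r j + ((r == y) && (j == i)) = cnt x r j + ((r == y) && (j == i.+1)).

Variables F E : nat -> nat -> X -> X.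

Hypothesis cnt_height : forall x r j, h <= r -> cnt x r j = 0.

(** In terms of [excess], the two inequalities say that the value at row [y] is at least the one
    before and exceeds the one after; in [EP] the strictness is exchanged. For [y = 0] the value
    before counts as 0. *)
Hypothesis FP : forall i y x, i < k -> y < h -> P x ->
  prev_cnt x i y <= cnt x y i.+1 -> cnt x y.+1 i.+1 < cnt x y i ->
  [/\ P (F i y x), moved i y x (F i y x) & E i y (F i y x) = x].

Hypothesis EP : forall i y x, i < k -> y < h -> P x ->
  prev_cnt x i y < cnt x y i.+1 -> cnt x y.+1 i.+1 <= cnt x y i ->
  [/\ P (E i y x), moved i y (E i y x) x & F i y (E i y x) = x].

Lemma cumS x j y : cum x j y.+1 = cum x j y + cnt x y j.
Proof. by rewrite /cum big_ord_recr. Qed.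

Lemma cum0 x j : cum x j 0 = 0.
Proof. by rewrite /cum big_ord0. Qed.

Lemma wtS x j : cum x j h.+1 = wt x j.
Proof. by rewrite cumS cnt_height ?addn0. Qed.

Lemma excessS i x y :
  excess i x y.+1 = (excess i x y + (cnt x y.+1 i.+1)%:Z - (cnt x y i)%:Z)%R.
Proof. rewrite /excess (cumS x _ y.+1) (cumS x i y); lia. Qed.

Lemma excess0 i x : excess i x 0 = cnt x 0 i.+1.
Proof. rewrite /excess cumS !cum0; lia. Qed.

Lemma excess_top i x : excess i x h = ((wt x i.+1)%:Z - (wt x i)%:Z)%R.
Proof. by rewrite /excess wtS. Qed.

Lemma cum_moved i y x x' j t : moved i y x x' ->
  cum x' j t + ((y < t) && (j == i)) = cum x j t + ((y < t) && (j == i.+1)).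
Proof.
move=> mv; elim: t => [|t IHt]; first by rewrite !cum0.
have := mv t j; rewrite !cumS; move: IHt.
by case: (ltngtP y t) => ?; case: (j == i); case: (j == i.+1); lia.
Qed.

(** The new [i+1] counts from row [y] on, the lost [i] only from the next row on. *)
Lemma excess_moved i y x x' t : moved i y x x' ->
  excess i x' t = (excess i x t + (y <= t)%:Z + (y < t)%:Z)%R.
Proof.
move=> mv; have := cum_moved i.+1 t.+1 mv; have := cum_moved i t mv.
rewrite !eqxx ltnS !andbT (gtn_eqF (ltnSn i)) (ltn_eqF (ltnSn i)) !andbF /excess; lia.
Qed.

(** The number of unmatched [i+1]. Truncating negative differences to 0 does not affect the maximum,
    since [excess] is nonnegative at row 0. *)
Definition eps i x := \max_(y < h.+1) (cum x i.+1 y.+1 - cum x i y).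

Lemma eps_ub i x y : y <= h -> (excess i x y <= (eps i x)%:Z)%R.
Proof.
rewrite -ltnS => yh; have := leq_bigmax (F := fun y : 'I_h.+1 =>
  cum x i.+1 y.+1 - cum x i y) (Ordinal yh).
rewrite -/(eps i x) /excess /=; lia.
Qed.

Lemma eps_reached i x : exists2 y, y <= h & excess i x y = eps i x.
Proof.
have [y0 e0] : {y0 : 'I_h.+1 | eps i x = (cum x i.+1 y0.+1 - cum x i y0)}.
  have cardh : 0 < #|'I_h.+1| by rewrite card_ord.
  have [y0 e0] := bigop.eq_bigmax (fun y : 'I_h.+1 => cum x i.+1 y.+1 - cum x i y) cardh.
  by exists y0.
have [le|lt] := leqP (cum x i y0) (cum x i.+1 y0.+1).
  exists y0; first by rewrite -ltnS.
  by rewrite e0 /excess; lia.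
(* Here the maximum is a truncated difference, hence 0, and row 0 attains it. *)
exists 0 => //; have := eps_ub i x (leq0n h).
rewrite excess0; lia.
Qed.

Lemma eps_eq i x n : (forall y, y <= h -> (excess i x y <= n%:Z)%R) ->
  (exists2 y, y <= h & excess i x y = n) -> eps i x = n.
Proof.
move=> ub [y yh ey]; have := eps_ub i x yh; rewrite ey.
by have [z /ub zn ez] := eps_reached i x; rewrite ez in zn; lia.
Qed.

(* For the word of sorted rows, the last maximum of [excess] is the row of the
   rightmost unmatched i, and the first maximum the row of the leftmost unmatched
   i+1: these are the letters changed by the crystal operators. *)
Definition fpos i x y := (y < h) && [forall t : 'I_h.+1,
  if t <= y then (excess i x t <= excess i x y)%R else (excess i x t < excess i x y)%R].

Definition epos i x y := [&& y < h, (0 < excess i x y)%R & [forall t : 'I_h.+1,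
  if t < y then (excess i x t < excess i x y)%R else (excess i x t <= excess i x y)%R]].

Lemma fposP i x y : reflect
  [/\ y < h, excess i x y = eps i x
    & forall t, y < t -> t <= h -> (excess i x t < excess i x y)%R] (fpos i x y).
Proof.
apply: (iffP andP) => [[yh /forallP le_y] | [yh ey lt_y]].
  have lt_y t : y < t -> t <= h -> (excess i x t < excess i x y)%R.
    by move=> yt th; have := le_y (Ordinal (th : t < h.+1)); rewrite leqNgt yt.
  split=> //; have [z zh ez] := eps_reached i x; rewrite -ez.
  have := le_y (Ordinal (zh : z < h.+1)); have := eps_ub i x (ltnW yh); rewrite -ez /=.
  case: ifP; lia.
split=> //; apply/forallP => t; have th : t <= h by rewrite -ltnS.
by case: leqP => [_ | /lt_y->//]; rewrite ey eps_ub.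
Qed.

Lemma eposP i x y : reflect
  [/\ y < h, (0 < excess i x y)%R, excess i x y = eps i x
    & forall t, t < y -> (excess i x t < excess i x y)%R] (epos i x y).
Proof.
apply: (iffP and3P) => [[yh y0 /forallP le_y] | [yh y0 ey lt_y]].
  have lt_y t : t < y -> (excess i x t < excess i x y)%R.
    move=> ty; have th : t < h.+1 by lia.
    by have := le_y (Ordinal th); rewrite /= ty.
  split=> //; have [z zh ez] := eps_reached i x; rewrite -ez.
  have := le_y (Ordinal (zh : z < h.+1)); have := eps_ub i x (ltnW yh); rewrite -ez /=.
  case: ifP; lia.
split=> //; apply/forallP => t; have th : t <= h by rewrite -ltnS.
by case: ltnP => [/lt_y->// | _]; rewrite ey eps_ub.
Qed.

Definition fstep i x := if [pick y : 'I_h | fpos i x y] is Some y then F i y x else x.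
Definition estep i x := if [pick y : 'I_h | epos i x y] is Some y then E i y x else x.

Lemma fposE i x y : fpos i x y -> fstep i x = F i y x.
Proof.
move=> /fposP[yh ey lt_y]; rewrite /fstep; case: pickP =>
  [z /fposP[zh ez lt_z] | /(_ (Ordinal yh))].
  congr F; case: (ltngtP z y) => // [zy | yz].
    by have := lt_z _ zy (ltnW yh); rewrite ez ey; lia.
  by have := lt_y _ yz (ltnW zh); rewrite ez ey; lia.
by move/negbT/negP; case; apply/fposP.
Qed.

Lemma eposE i x y : epos i x y -> estep i x = E i y x.
Proof.
move=> /eposP[yh y0 ey lt_y]; rewrite /estep;
  case: pickP => [z /eposP[zh z0 ez lt_z] | /(_ (Ordinal yh))].
  congr E; case: (ltngtP z y) => // [zy | yz].
    by have := lt_y _ zy; rewrite ez ey; lia.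
  by have := lt_z _ yz; rewrite ez ey; lia.
by move/negbT/negP; case; apply/eposP.
Qed.

(** The hypothesis keeps the last maximum away from the empty row [h], so that it is a row in which
    a letter can be changed. *)
Lemma fpos_ex i x : (excess i x h < (eps i x)%:Z)%R -> exists y, fpos i x y.
Proof.
move=> top; have [z zh ez] := eps_reached i x.
have exQ : exists y, (y <= h) && (excess i x y == eps i x) by exists z; rewrite zh ez eqxx.
have ubQ y : (y <= h) && (excess i x y == eps i x) -> y <= h by case/andP.
case: (ex_maxnP exQ ubQ) => y /andP[yh /eqP ey] max_y; exists y; apply/fposP; split=> //.
  by rewrite ltn_neqAle yh andbT; apply: contraTneq top => <-; rewrite ey ltxx.
move=> t yt th; have := eps_ub i x th; rewrite ey le_eqVlt => /orP[et | //].
by have := max_y t; rewrite th et => /(_ isT); lia.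
Qed.

Lemma epos_ex i x : 0 < eps i x -> exists y, epos i x y.
Proof.
move=> top; have [z zh ez] := eps_reached i x.
have exQ : exists y, (y <= h) && (excess i x y == eps i x) by exists z; rewrite zh ez eqxx.
case: (ex_minnP exQ) => y /andP[yh /eqP ey] min_y; exists y.
have lt_y t : t < y -> (excess i x t < excess i x y)%R.
  move=> ty; have th : t <= h by lia.
  have := eps_ub i x th; rewrite ey le_eqVlt => /orP[et | //].
  by have := min_y t; rewrite th et => /(_ isT); lia.
apply/eposP; split=> //; last by rewrite ey; lia.
(* The first maximum is not at the empty row [h]: no [i+1] is added there, so the row before has at
   least the same value. *)
rewrite ltn_neqAle yh andbT; apply/eqP => eyh; move: lt_y ey top; rewrite eyh.
case: (h) cnt_height => [|h'] cnt0 lt_y; first by rewrite excess0 cnt0 //; lia.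
by have := lt_y h' (ltnSn _); rewrite excessS cnt0 //; lia.
Qed.

(** As [y] is the last maximum, earlier rows keep values at most [eps], row [y] reaches [eps + 1],
    and later rows gain 2 from values below [eps]. So [y] becomes the first maximum, which is the
    row where lowering acts. *)
Lemma raise_fpos i x y (x' := F i y x) : i < k -> P x -> fpos i x y ->
  [/\ P x', moved i y x x', epos i x' y, eps i x' = (eps i x).+1 & E i y x' = x].
Proof.
move=> ik Px /fposP[yh ey lt_y].
have le1 : prev_cnt x i y <= cnt x y i.+1.
  case: (y) yh ey => [|r] //= rh ey.
  have := eps_ub i x (leq_trans (leqnSn r) (ltnW rh)).
  by rewrite -ey excessS; lia.
have le2 : cnt x y.+1 i.+1 < cnt x y i.
  by have := lt_y _ (ltnSn y) yh; rewrite excessS; lia.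
have [Px' mv back] := FP ik yh Px le1 le2; rewrite -/x' in Px' mv back.
have ex' := excess_moved _ mv.
have e' : eps i x' = (eps i x).+1.
  apply: eps_eq => [t th | ]; last first.
    by exists y; [exact: ltnW | rewrite ex' leqnn ltnn ey; lia].
  rewrite ex'; case: (ltngtP t y) => [ty | yt | ->].
  - by have := eps_ub i x th; lia.
  - by have := lt_y _ yt th; lia.
  - by rewrite ey; lia.
split=> //; apply/eposP; split=> //.
- by rewrite ex' ey leqnn ltnn; lia.
- by rewrite e' ex' ey leqnn ltnn; lia.
move=> t ty; have th : t <= h by lia.
by have := eps_ub i x th; rewrite !ex' leqnn ltnn ey; lia.
Qed.

Lemma fstepP i x : i < k -> P x -> (excess i x h < (eps i x)%:Z)%R ->
  exists2 y, fpos i x y & let x' := fstep i x in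
  [/\ P x', moved i y x x', eps i x' = (eps i x).+1 & estep i x' = x].
Proof.
move=> ik Px /fpos_ex[y fy]; exists y => //; rewrite /= (fposE fy).
by have [Px' mv ey' -> back] := raise_fpos ik Px fy; rewrite (eposE ey').
Qed.

(** After lowering in row [y], this row is the last maximum, so [raise_fpos] applied to the result
    gives the change of [eps]. *)
Lemma estepP i x : i < k -> P x -> 0 < eps i x ->
  exists2 y, epos i x y & let x' := estep i x in
  [/\ P x', moved i y x' x, eps i x = (eps i x').+1 & fstep i x' = x].
Proof.
move=> ik Px /epos_ex[y fy]; exists y => //; rewrite /= (eposE fy).
case/eposP: fy => yh y0 ey lt_y.
have le1 : prev_cnt x i y < cnt x y i.+1.
  case: (y) yh y0 ey lt_y => [|r] //= rh; first by rewrite excess0; lia.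
  by move=> _ ey lt_y; have := lt_y _ (ltnSn r); rewrite excessS; lia.
have le2 : cnt x y.+1 i.+1 <= cnt x y i.
  by have := eps_ub i x yh; rewrite excessS -ey; lia.
have [Px' mv FE] := EP ik yh Px le1 le2; set x' := E i y x in Px' mv FE *.
have fy : fpos i x' y.
  apply/andP; split=> //; apply/forallP => t; have th : t <= h by rewrite -ltnS.
  have := excess_moved t mv; have := excess_moved y mv; rewrite leqnn ltnn.
  have := eps_ub i x th; rewrite -ey; have := lt_y t.
  by case: (ltngtP t y) => [ty /(_ isT) | yt | ->]; lia.
have [_ _ _ + _] := raise_fpos ik Px' fy; rewrite FE => <-.
by split=> //; rewrite (fposE fy).
Qed.

(** * Strings and their lengths *)

Definition phi i x := eps i x + wt x i - wt x i.+1.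

(** The subtraction in [phi], the number of unmatched [i], is never truncated, because [eps] bounds
    the final surplus. *)
Lemma phiE i x : phi i x + wt x i.+1 = eps i x + wt x i.
Proof. by have := eps_ub i x (leqnn h); rewrite excess_top /phi; lia. Qed.

Lemma wt_moved i y x x' j : y < h -> moved i y x x' ->
  wt x' j + (j == i) = wt x j + (j == i.+1).
Proof. by move=> yh /(cum_moved j h); rewrite yh. Qed.

Lemma phi_gt0 i x : (0 < phi i x) = (excess i x h < (eps i x)%:Z)%R.
Proof. by have := phiE i x; rewrite excess_top; lia. Qed.


Lemma wtE i y x x' : y < h -> moved i y x x' ->
  [/\ wt x' i + 1 = wt x i, wt x' i.+1 = wt x i.+1 + 1
    & forall j, j != i -> j != i.+1 -> wt x' j = wt x j].
Proof.
move=> yh mv; have e := wt_moved _ yh mv; split.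
- by have := e i; rewrite eqxx (ltn_eqF (ltnSn i)) addn0.
- by have := e i.+1; rewrite eqxx (gtn_eqF (ltnSn i)) addn0.
by move=> j /negPf ji /negPf jSi; have := e j; rewrite ji jSi !addn0.
Qed.

(** The data that moves along an [i]-string leave alone when they act in row [y0] or above. *)
Definition agree y0 i x x' :=
  (forall r j, r < y0 -> cnt x' r j = cnt x r j) /\
  (forall j, j != i -> j != i.+1 -> cnt x' y0 j = cnt x y0 j).

Definition violates y0 i x := [/\ y0 <= h, (0 < excess i x y0)%R
  & forall t, t < y0 -> (excess i x t <= 0)%R].

Lemma agree_trans y0 i x2 x1 x3 : agree y0 i x1 x2 -> agree y0 i x2 x3 -> agree y0 i x1 x3.
Proof.
by case=> a1 b1 [a2 b2]; split=> [r j lt|j ne1 ne2]; [rewrite a2 ?a1 | rewrite b2 ?b1].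
Qed.

Lemma moved_agree y0 i y x x' : y0 <= y -> moved i y x x' -> agree y0 i x x' /\ agree y0 i x' x.
Proof.
move=> yy mv; split; split=> [r j lt|j /negPf ne1 /negPf ne2].
- by have := mv r j; rewrite (ltn_eqF (leq_trans lt yy)) !addn0.
- by have := mv y0 j; rewrite ne1 ne2 !andbF !addn0.
- by have := mv r j; rewrite (ltn_eqF (leq_trans lt yy)) !addn0.
- by have := mv y0 j; rewrite ne1 ne2 !andbF !addn0.
Qed.

Lemma agree_cum y0 i x x' j y : agree y0 i x x' -> y <= y0 -> cum x' j y = cum x j y.
Proof.
by move=> [a _] yy; apply: eq_bigr => r _; apply: a; exact: leq_trans (ltn_ord r) yy.
Qed.

Lemma agree_violates y0 i x x' : agree y0 i x x' -> (0 < excess i x' y0)%R ->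
  violates y0 i x -> violates y0 i x'.
Proof.
move=> ag pos [yh _ neg]; split=> // t ty; have := neg t ty.
by rewrite /excess !(agree_cum _ ag) // ltnW.
Qed.

(** The changed row is a maximum of [excess], so it cannot lie below the first row with a positive
    value. *)
Lemma fstep_violates y0 i x : i < k -> P x -> (excess i x h < (eps i x)%:Z)%R ->
  violates y0 i x -> violates y0 i (fstep i x) /\ agree y0 i x (fstep i x).
Proof.
move=> ik Px top vx; have [y /fposP[yh ey lt_y] [_ mv _ _]] := fstepP ik Px top.
have yy : y0 <= y.
  by rewrite leqNgt; apply/negP => lt; case: vx => y0h + /(_ _ lt); have := eps_ub i x y0h; lia.
have [ag _] := moved_agree yy mv; split=> //; apply: (agree_violates ag _ vx).
by case: vx => _ pos _; rewrite (excess_moved _ mv); lia.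
Qed.

(** Lowering decreases the value at row [y0] only if this row is itself the first maximum, and then
    [1 < eps i x] keeps it positive. *)
Lemma estep_violates y0 i x : i < k -> P x -> 1 < eps i x ->
  violates y0 i x -> violates y0 i (estep i x) /\ agree y0 i x (estep i x).
Proof.
move=> ik Px e1 vx; have [y /eposP[yh y_gt0 ey lt_y] [_ mv _ _]] := estepP ik Px (ltnW e1).
have yy : y0 <= y.
  by rewrite leqNgt; apply/negP => lt; case: vx => y0h + /(_ _ lt); have := eps_ub i x y0h; lia.
have [_ ag] := moved_agree yy mv; split=> //; apply: (agree_violates ag _ vx).
have := excess_moved y0 mv; case: vx => y0h pos _.
by move: yy; rewrite leq_eqVlt => /orP[/eqP ->|]; rewrite ?leqnn ?ltnn; lia.
Qed.

(** The parameter [n] is the value of [eps] to be reached, which identifies an element within its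
    [i]-string. *)
Definition string_move i n x :=
  if eps i x <= n then iter (n - eps i x) (fstep i) x else iter (eps i x - n) (estep i) x.

Lemma iter_fstep i x n : i < k -> P x -> n <= phi i x -> let x' := iter n (fstep i) x in
  [/\ P x', eps i x' = eps i x + n, iter n (estep i) x' = x,
      [/\ wt x' i + n = wt x i, wt x' i.+1 = wt x i.+1 + n
        & forall j, j != i -> j != i.+1 -> wt x' j = wt x j]
    & forall y0, violates y0 i x -> violates y0 i x' /\ agree y0 i x x'].
Proof.
move=> ik Px; elim: n => [|n IHn] /=; first by rewrite !addn0; split.
move=> nphi; have [] := IHn (ltnW nphi); set x' := iter _ _ x.
move=> Px' e' it [w1 w2 w3] vi.
have top : (excess i x' h < (eps i x')%:Z)%R.
  by rewrite -phi_gt0; have := phiE i x'; have := phiE i x; lia.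
have [y /fposP[yh _ _] [Px'' mv e'' st]] := fstepP ik Px' top.
have [v1 v2 v3] := wtE yh mv; split=> //.
- by rewrite e'' e' addnS.
- by rewrite -iterS iterSr st.
- by split=> [||j j1 j2]; [lia | lia | rewrite v3 ?w3].
move=> y0 /vi[vx' ag]; have [vx'' ag'] := fstep_violates ik Px' top vx'.
by split=> //; exact: agree_trans ag ag'.
Qed.

Lemma iter_estep i x n : i < k -> P x -> n <= eps i x -> let x' := iter n (estep i) x in
  [/\ P x', eps i x' + n = eps i x, iter n (fstep i) x' = x,
      [/\ wt x' i = wt x i + n, wt x' i.+1 + n = wt x i.+1
        & forall j, j != i -> j != i.+1 -> wt x' j = wt x j]
    & n < eps i x -> forall y0, violates y0 i x -> violates y0 i x' /\ agree y0 i x x'].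
Proof.
move=> ik Px; elim: n => [|n IHn] /=; first by rewrite !addn0; split.
move=> neps; have [] := IHn (ltnW neps); set x' := iter _ _ x.
move=> Px' e' it [w1 w2 w3] vi.
have pos : 0 < eps i x' by lia.
have [y /eposP[yh _ _ _] [Px'' mv e'' st]] := estepP ik Px' pos.
have [v1 v2 v3] := wtE yh mv; split=> //.
- by lia.
- by rewrite -iterS iterSr st.
- by split=> [||j j1 j2]; [lia | lia | rewrite -v3 ?w3].
move=> lt y0 /(vi neps)[vx' ag].
have e2 : 1 < eps i x' by lia.
have [vx'' ag'] := estep_violates ik Px' e2 vx'.
by split=> //; exact: agree_trans ag ag'.
Qed.

Lemma string_moveP i x n : i < k -> P x -> n <= eps i x + phi i x ->
  let x' := string_move i n x in
  [/\ P x', eps i x' = n, string_move i (eps i x) x' = x,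
      [/\ wt x' i + n = wt x i + eps i x, wt x' i.+1 + eps i x = wt x i.+1 + n
        & forall j, j != i -> j != i.+1 -> wt x' j = wt x j]
    & 0 < n -> forall y0, violates y0 i x -> violates y0 i x' /\ agree y0 i x x'].
Proof.
move=> ik Px nle x'; case: (leqP (eps i x) n) => [le|lt].
  have -> : x' = iter (n - eps i x) (fstep i) x by rewrite /x' /string_move le.
  have nphi : n - eps i x <= phi i x by lia.
  have [] := iter_fstep ik Px nphi; set x1 := iter _ _ x.
  move=> Px' e' it [w1 w2 w3] vi; split=> //.
  - by lia.
  - rewrite /string_move e'; case: leqP => [le'|_].
      suff e0 : n = eps i x by rewrite /x1 e0 !subnn /= addn0 subnn.
      by lia.
    by rewrite addKn.
  - by split; [lia | lia |].
have -> : x' = iter (eps i x - n) (estep i) x by rewrite /x' /string_move leqNgt lt.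
have neps : eps i x - n <= eps i x by lia.
have [] := iter_estep ik Px neps; set x1 := iter _ _ x.
move=> Px' e' it [w1 w2 w3] vi; split=> //.
- by lia.
- rewrite /string_move ifT; last by lia.
  by rewrite (_ : eps i x - eps i x1 = eps i x - n) //; lia.
- by split; [lia | lia |].
by move=> n0; apply: vi; lia.
Qed.

(** * Symmetry of the weights and the sign-reversing involution *)

Definition content x : {ffun 'I_k.+1 -> int} := [ffun j => Posz (wt x (val j))].

Definition rho : {ffun 'I_k.+1 -> int} := [ffun j => Posz (k - val j)].

(** The highest weight condition: [eps i x = 0] for every [i]. *)
Definition good x := [forall y : 'I_h.+1, [forall i : 'I_k, (excess i x y <= 0)%R]].

Definition weights (c : {ffun 'I_k.+1 -> int}) := #|[pred x | P x && (content x == c)]|.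

Definition highest_weights (c : {ffun 'I_k.+1 -> int}) := #|[pred x | [&& P x,
  good x & content x == c]]|.

Definition adj (i : 'I_k) : 'S_k.+1 := tperm (inord i) (inord i.+1).

Lemma adjE (i : 'I_k) j : val (adj i j) =
  if val j == i then i.+1 else if val j == i.+1 then nat_of_ord i else val j.
Proof.
have i1 : val (inord i : 'I_k.+1) = i by apply: inordK; rewrite ltnW // ltnS.
have i2 : val (inord i.+1 : 'I_k.+1) = i.+1 by apply: inordK; rewrite ltnS.
rewrite /adj permE /= -!val_eqE i1 i2.
by case: eqP => // _; case: eqP.
Qed.

(** Reversing each [i]-string is an involution that exchanges [eps] and [phi], hence the
    multiplicities of [i] and [i+1]. *)
Lemma weights_adj i (c : {ffun 'I_k.+1 -> int}) : weights [ffun j => c (adj i j)] = weights c.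
Proof.
pose R x := string_move i (phi i x) x.
have RP x : P x -> P (R x) /\ R (R x) = x /\ content (R x) = [ffun j => content x (adj i j)].
  move=> Px; have [] := string_moveP (ltn_ord i) Px (leq_addl _ _); rewrite -/(R x).
  move=> PR eR RR [w1 w2 w3] _; split=> //; have e := phiE i x; have e' := phiE i (R x).
  split; first by rewrite {1}/R (_ : phi i (R x) = eps i x) //; lia.
  apply/ffunP => j; rewrite !ffunE adjE; congr Posz.
  by case: eqP => [-> | /eqP j1]; [lia | case: eqP => [-> | /eqP j2]; [lia | exact: w3]].
apply: (@eq_card_bij _ _ _ _ R R) => x /andP[Px /eqP cx]; have [PR [RR cR]] := RP x Px;
  rewrite !inE PR RR cR cx;
  split=> //=; apply/eqP/ffunP => j; rewrite !ffunE //.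
by rewrite tpermK.
Qed.

(* The least row with a violation and in it the largest letter: moving along the
   i-string changes only letters i and i+1 in this row and above it, hence not
   this choice. *)
Definition chosen x (q : 'I_h.+1 * 'I_k) :=
  [&& (0 < excess q.2 x q.1)%R,
      [forall t : 'I_h.+1, (t < q.1) ==> [forall j : 'I_k, (excess j x t <= 0)%R]]
    & [forall j : 'I_k, (q.2 < j) ==> (excess j x q.1 <= 0)%R]].

Lemma chosenP x (q : 'I_h.+1 * 'I_k) : reflect [/\ (0 < excess q.2 x q.1)%R,
  forall t (j : 'I_k), t < q.1 -> (excess j x t <= 0)%R
  & forall j : 'I_k, q.2 < j -> (excess j x q.1 <= 0)%R] (chosen x q).
Proof.
apply: (iffP and3P) => [[pos /forallP lo /forallP hi] | [pos lo hi]]; split=> //.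
- move=> t j tq; have th : t < h.+1 by exact: ltn_trans (ltn_ord q.1).
  by have := lo (Ordinal th); rewrite /= tq => /forallP.
- by move=> j; apply/implyP.
- by apply/forallP => t; apply/implyP => tq; apply/forallP => j; exact: lo.
by apply/forallP => j; apply/implyP; exact: hi.
Qed.

Lemma chosen_uniq x q q' : chosen x q -> chosen x q' -> q = q'.
Proof.
case: q q' => [y i] [y' i'] /chosenP[/= pos lo hi] /chosenP[/= pos' lo' hi'].
have eyy : y = y'.
  apply/val_inj; case: (ltngtP y y') => //.
    by move=> /(lo' _ i); lia.
  by move=> /(lo _ i'); lia.
rewrite -eyy in pos' hi' *; congr pair; apply/val_inj; case: (ltngtP i i') => //.
  by move=> /hi; lia.
by move=> /hi'; lia.
Qed.

Lemma chosen_ex x : ~~ good x -> exists q, chosen x q.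
Proof.
case/forallPn => y /forallPn[i]; rewrite -ltNge => pos.
have exy : exists t, (t < h.+1) && [exists j : 'I_k, (0 < excess j x t)%R].
  by exists y; rewrite ltn_ord; apply/existsP; exists i.
case: (ex_minnP exy) => {y i pos exy} y /andP[yh /existsP[i pos]] min_y.
have exi : exists j, [exists j' : 'I_k, (val j' == j) && (0 < excess j' x y)%R].
  by exists (val i); apply/existsP; exists i; rewrite eqxx.
have ubi j : [exists j' : 'I_k, (val j' == j) && (0 < excess j' x y)%R] -> j <= k.
  by case/existsP => j' /andP[/eqP <- _]; exact: (ltnW (ltn_ord j')).
case: (ex_maxnP exi ubi) => {exi ubi i pos} _ /existsP[i /andP[/eqP <- pos]] max_i.
exists (Ordinal yh, i); apply/chosenP; split=> //= [t j ty | j ij].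
  rewrite leNgt; apply/negP => pos'; suff : y <= t by lia.
  by apply: min_y; rewrite (ltn_trans ty yh); apply/existsP; exists j.
rewrite leNgt; apply/negP => pos'; suff : j <= i by lia.
by apply: max_i; apply/existsP; exists j; rewrite eqxx.
Qed.

Lemma chosen_agree (y0 : 'I_h.+1) (i : 'I_k) x x' : agree y0 i x x' -> (0 < excess i x' y0)%R ->
  chosen x (y0, i) -> chosen x' (y0, i).
Proof.
move=> ag pos' /chosenP[/= pos lo hi]; apply/chosenP; split=> //= [t j ty | j ij].
  by have := lo t j ty; rewrite /excess !(agree_cum _ ag) // ltnW.
have := hi j ij; rewrite /excess !cumS !(agree_cum _ ag) //.
by case: ag => _ ->; lia.
Qed.

(** Aiming at [eps = phi + 1], rather than [phi], turns the weight [wt] into [s_i(wt + rho) - rho].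
    The result has [phi] equal to the old [eps - 1], so a second application leads back. *)
Definition reflect_bad (p : 'S_k.+1 * X) : 'S_k.+1 * X :=
  if [pick q | chosen p.2 q] is Some q then
    ((adj q.2 * p.1)%g, string_move q.2 (phi q.2 p.2).+1 p.2)
  else p.

Lemma reflect_badE p q : chosen p.2 q ->
  reflect_bad p = ((adj q.2 * p.1)%g, string_move q.2 (phi q.2 p.2).+1 p.2).
Proof.
move=> ch; rewrite /reflect_bad; case: pickP => [q' /(chosen_uniq ch) <- // | /(_ q)].
by rewrite ch.
Qed.

Lemma reflect_badP p (p' := reflect_bad p) : P p.2 -> ~~ good p.2 ->
  [/\ P p'.2, ~~ good p'.2, reflect_bad p' = p, ((-1) ^+ p'.1 = - (-1) ^+ p.1 :> int)%R
   & forall c : {ffun 'I_k.+1 -> int},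
     (content p.2 == [ffun j => c (p.1 j) - rho j]%R) ->
     (content p'.2 == [ffun j => c (p'.1 j) - rho j]%R)].
Proof.
move=> Px /chosen_ex[[y i] ch]; rewrite /p' (reflect_badE ch) /=.
case: p Px ch {p'} => s x /= Px ch; have /chosenP[/= pos lo hi] := ch.
have e_gt0 : 0 < eps i x by have := eps_ub i x (ltn_ord y : y <= h); lia.
have le : (phi i x).+1 <= eps i x + phi i x by lia.
have [] := string_moveP (ltn_ord i) Px le; set x' := string_move _ _ _.
move=> Px' e' back [w1 w2 w3] /(_ isT y)[|[_ pos' _] ag].
  by split=> // [|t ty]; [rewrite -ltnS | exact: lo].
have ch' : chosen x' (y, i) by exact: chosen_agree ag pos' ch.
have ep := phiE i x; have ep' := phiE i x'.
split=> //.
- apply/negP => /forallP/(_ y)/forallP/(_ i); lia.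
- rewrite (reflect_badE (q := (y, i))) //= (_ : (phi i x').+1 = eps i x); last by lia.
  by rewrite back mulgA tperm2 mul1g.
- rewrite odd_permM signr_addb odd_tperm (_ : inord i != inord i.+1 :> 'I_k.+1).
    by rewrite expr1 mulN1r.
  rewrite -val_eqE /= !inordK ?ltnS //; last by rewrite ltnW.
  by rewrite (ltn_eqF (ltnSn i)).
move=> c /eqP/ffunP cx; apply/eqP/ffunP => j; have := cx (adj i j).
rewrite !ffunE adjE permM; have := ltn_ord i.
by case: eqP => [-> | /eqP j1]; [lia | case: eqP => [-> | /eqP j2]; [lia | rewrite w3]].
Qed.

Lemma good_content x : good x -> forall i j : 'I_k.+1, i <= j -> (content x j <= content x i)%R.
Proof.
move=> /forallP/(_ ord_max)/forallP /= gx i [j jk]; elim: j jk => [|j IHj] jk /=.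
  by rewrite leqn0 => /eqP i0; rewrite (_ : Ordinal jk = i) //; exact/val_inj.
rewrite leq_eqVlt => /orP[/eqP ij | ]; first by rewrite (_ : Ordinal jk = i) //; exact/val_inj.
rewrite ltnS => /(IHj (ltnW jk)); apply: le_trans; rewrite !ffunE /=.
have := gx (Ordinal (jk : j < k)); rewrite /= excess_top; lia.
Qed.

(** The sum counts pairs of a permutation and an element of the corresponding weight. The bad pairs
    cancel under [reflect_bad]; in a good pair the weight is weakly decreasing, which forces the
    permutation to be the identity. *)
Lemma weights_alternating (c : {ffun 'I_k.+1 -> int}) :
  (forall i j : 'I_k.+1, i <= j -> (c j <= c i)%R) ->
  (\sum_(s : 'S_k.+1) (-1) ^+ s * (weights [ffun j => c (s j) + rho (s j) - rho j])%:Z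
   = (highest_weights c)%:Z)%R.
Proof.
move=> dec_c; pose l : {ffun 'I_k.+1 -> int} := [ffun j => c j + rho j]%R.
pose Q (p : 'S_k.+1 * X) := content p.2 == [ffun j => l (p.1 j) - rho j]%R.
have lhs : (\sum_(s : 'S_k.+1) (-1) ^+ s * (weights [ffun j => c (s j) + rho (s j) - rho j])%:Z
  = \sum_(p | P p.2 && Q p) (-1) ^+ p.1 :> int)%R.
  rewrite (eq_bigr (fun s : 'S_k.+1 => \sum_(x | P x && Q (s, x)) (-1) ^+ s))%R => [|s _].
    by rewrite pair_big_dep.
  rewrite sumr_const -mulr_natr natz; congr (_ * (_%:Z))%R; apply: eq_card => x.
  by rewrite !inE /Q /=; congr (_ && (_ == _)); apply/ffunP => j; rewrite !ffunE.
rewrite {}lhs (bigID (fun p => good p.2)) /= [X in (_ + X)%R](_ : _ = 0%R) ?addr0; last first.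
  (* Reindexing by the sign-reversing involution shows that the sum is its own negative. *)
  set S := (\sum_(_ | _) _)%R; suff : (S = - S)%R by lia.
  rewrite {1}/S (reindex_onto reflect_bad reflect_bad) => [|p /andP[/andP[Pp Qp] bp]];
    last first.
    by have [] := reflect_badP Pp bp.
  rewrite /S -sumrN; apply: eq_big => [p | p /andP[/andP[/andP[Pp Qp] bp] /eqP inv]];
    last first.
    by have [_ _ _] := reflect_badP Pp bp; rewrite inv => -> _; rewrite opprK.
  apply/andP/andP => [[/andP[/andP[Pp Qp] bp] /eqP inv] | [/andP[Pp Qp] bp]].
    by have [Pp' bp' _ _ /(_ l Qp)] := reflect_badP Pp bp; rewrite inv in Pp' bp' * => Qp';
      rewrite /Q Qp' Pp'.
  have [-> -> -> _ /(_ l Qp)] := reflect_badP Pp bp; rewrite eqxx; split=> //.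
  by rewrite andbT.
rewrite (eq_bigl (fun p => (p.1 == 1%g) && [&& P p.2, good p.2 & content p.2 == c])) =>
  [|[s x]] /=.
  rewrite -(pair_big_dep (fun s : 'S_k.+1 => s == 1%g)
    (fun _ x => [&& P x, good x & content x == c])
    (fun (s : 'S_k.+1) _ => (-1) ^+ s)%R) /=.
  by rewrite big_pred1_eq odd_perm1 expr0 sumr_const natz.
rewrite /Q /=; apply/idP/idP => [/andP[/andP[Px /eqP cx] gx] | /and4P[/eqP -> Px gx /eqP cx]];
  last first.
  by rewrite Px gx !andbT; apply/eqP/ffunP => j; rewrite cx !ffunE perm1 addrK.
(* Since [c] and the content of [x] decrease weakly and [rho] strictly, an inversion of [s] would
   contradict the equality of contents. *)
have s1 : s = 1%g.
  apply: perm_homo_ltn => i j ij; rewrite ltnNge; apply/negP => sji.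
  have := good_content gx (ltnW ij); have := dec_c _ _ sji.
  by move/ffunP: cx => cx; have := cx i; have := cx j; rewrite !ffunE /=; have := ltn_ord j;
    have := ltn_ord (s i); lia.
rewrite s1 eqxx Px gx /=; apply/eqP/ffunP => j; by rewrite cx s1 !ffunE perm1 addrK.
Qed.
End Crystal.

(** * Alternating sums determine symmetric functions *)

Section Alternating.

Variables (k n : nat) (D : {ffun 'I_k.+1 -> int} -> int).

Hypothesis D_bound : forall c, D c != 0%R -> forall j, (0 <= c j <= n%:Z)%R.
Hypothesis D_adj : forall i (c : {ffun 'I_k.+1 -> int}), D [ffun j => c (adj i j)] = D c.
Hypothesis D_alt : forall c : {ffun 'I_k.+1 -> int},
  (forall i j : 'I_k.+1, i <= j -> (c j <= c i)%R) ->
  (\sum_(s : 'S_k.+1) (-1) ^+ s * D [ffun j => c (s j) + rho k (s j) - rho k j] = 0)%R.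

(** Conjugation by an adjacent transposition takes the transposition of [i] and [j] to that of [i]
    and [j+1]. *)
Lemma tperm_invariant (i j : 'I_k.+1) (c : {ffun 'I_k.+1 -> int}) : D [ffun l =>
  c (tperm i j l)] = D c.
Proof.
wlog ij : i j c / i <= j.
  by move=> IH; case: (leqP i j) => [/IH->//|/ltnW /IH]; rewrite tpermC.
move: ij; case: j => j jk /= ij; elim: j jk ij c => [|j IHj] jk ij c.
  have -> : Ordinal jk = i by apply/val_inj/esym/eqP; rewrite -leqn0.
  by congr D; apply/ffunP => l; rewrite ffunE tperm1 perm1.
move: ij; rewrite leq_eqVlt => /orP[/eqP ij | ij].
  have -> : Ordinal jk = i by exact/val_inj.
  by congr D; apply/ffunP => l; rewrite ffunE tperm1 perm1.
have IH := IHj (ltnW jk) ij; set j1 := Ordinal (ltnW jk) in IH.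
set j2 := Ordinal jk; pose a := adj (Ordinal (jk : j < k)).
have aE : a = tperm j1 j2.
  by rewrite /a /adj; congr tperm; apply/val_inj; rewrite /= inordK // ltnW.
have ne1 : i != j1 \/ i = j1 by case: eqVneq; [right | left].
case: ne1 => [ne1 | ->]; last by rewrite -aE D_adj.
have ne2 : i != j2 by rewrite -val_eqE /= (ltn_eqF ij).
have -> : [ffun l => c (tperm i j2 l)] =
    [ffun l => [ffun l' => [ffun l'' => c (a l'')] (tperm i j1 l')] (a l)].
  apply/ffunP => l; rewrite !ffunE; congr (c _).
  have -> : tperm i j2 = (tperm i j1 ^ a)%g by rewrite tpermJ aE tpermL tpermD // eq_sym.
  by rewrite conjgE aE tpermV !permM.
by rewrite D_adj IH D_adj.
Qed.

Lemma perm_invariant (s : 'S_k.+1) (c : {ffun 'I_k.+1 -> int}) : D [ffun j => c (s j)] = D c.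
Proof.
case: (prod_tpermP s) => ts es _; rewrite {}es; elim: ts c => [|[i j] ts IHts] c.
  by rewrite big_nil; congr D; apply/ffunP => l; rewrite ffunE perm1.
rewrite big_cons -(IHts c); set t := (\prod_(_ <- ts) _)%g.
rewrite -[RHS](tperm_invariant i j); congr D.
by apply/ffunP => l; rewrite !ffunE permM.
Qed.

(** The potential for the induction in [alternating_eq0]. *)
Let M (c : {ffun 'I_k.+1 -> int}) := (\sum_j c j * rho k j)%R.

(** The vector [rho] and its rearrangement have the same norm, so twice this sum is the squared norm
    of their difference. *)
Lemma rho_dot_perm (s : 'S_k.+1) : s != 1%g ->
  (0 < \sum_j (rho k j - rho k (s j)) * rho k j)%R.
Proof.
move=> s1; have : (0 < \sum_j (rho k j - rho k (s j)) ^+ 2)%R.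
  have [j sj] : exists j, s j != j.
    apply/existsP; apply: contraR s1 => /existsPn /= id_s; apply/eqP/permP => j.
    by rewrite perm1; apply/eqP; have := id_s j; rewrite negbK.
  rewrite (bigD1 j) //= ltr_pwDl //; last by apply: sumr_ge0 => l _; rewrite sqr_ge0.
  rewrite lt0r sqr_ge0 andbT expf_eq0 /=; move: sj; rewrite -val_eqE !ffunE /=.
  by have := ltn_ord j; have := ltn_ord (s j); lia.
have -> : (\sum_j (rho k j - rho k (s j)) ^+ 2 =
   (\sum_j (rho k j - rho k (s j)) * rho k j) *+ 2)%R.
  have e : (\sum_j rho k (s j) ^+ 2 = \sum_j rho k j ^+ 2)%R.
    by rewrite [RHS](reindex_inj (@perm_inj _ s)).
  rewrite mulr2n -big_split /=.
  have -> : (\sum_j ((rho k j - rho k (s j)) * rho k j + (rho k j - rho k (s j)) * rho k j)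
    = \sum_j ((rho k j - rho k (s j)) ^+ 2 + (rho k j ^+ 2 - rho k (s j) ^+ 2)))%R.
    by apply: eq_bigr => j _; lia.
  by rewrite [RHS]big_split /= [X in (_ + X)%R](_ : _ = 0%R) ?addr0 // sumrB e subrr.
by rewrite pmulrn_lgt0.
Qed.

Lemma M_adj (i : 'I_k) (c : {ffun 'I_k.+1 -> int}) :
  M [ffun j => c (adj i j)] = (M c + c (inord i.+1) - c (inord i))%R.
Proof.
rewrite /M (reindex_inj (@perm_inj _ (adj i))) /=.
rewrite (eq_bigr (fun j => c j * rho k (adj i j))%R) => [|j _]; last by rewrite ffunE tpermK.
have ne : inord i.+1 != inord i :> 'I_k.+1.
  rewrite -val_eqE /= !inordK ?ltnS //; last exact: ltnW.
  by rewrite (gtn_eqF (ltnSn i)).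
rewrite (bigD1 (inord i)) //= (bigD1 (inord i.+1)) //=.
rewrite [in RHS](bigD1 (inord i)) //= [in RHS](bigD1 (inord i.+1)) //=.
rewrite [X in (_ + (_ + X) = _)%R](_ :
  _ = \sum_(i0 | (i0 != inord i) && (i0 != inord i.+1)) c i0 * rho k i0)%R; last first.
  by apply: eq_bigr => j /andP[j1 j2]; rewrite tpermD // eq_sym.
rewrite tpermL tpermR !ffunE /= !inordK ?ltnS //; last exact: ltnW.
rewrite (_ : k - i = (k - i.+1).+1); last by have := ltn_ord i; lia.
by set S := (\sum_(_ | _) _)%R; rewrite -(addn1 (k - _)) PoszD; ring.
Qed.

(** Downward induction on [M], which is bounded on the support of [D]. If [c] is not weakly
    decreasing, an adjacent swap increases [M]; otherwise the alternating relation expresses [D c]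
    by values of [D] at contents with larger [M]. *)
Lemma alternating_eq0 c : D c = 0%R.
Proof.
(* Each of the [k+1] summands of [M] is at most [n * k], since the entries of [rho] are at most
   [k]. *)
pose B := k.+1 * (n * k).
have M_bound c' : D c' != 0%R -> (M c' <= B%:Z)%R.
  move=> /D_bound c'b; apply: (@le_trans _ _ (\sum_(j < k.+1) (n * k)%:Z))%R.
    apply: ler_sum => j _; have /andP[c0 cn] := c'b j; rewrite PoszM ler_pM // ffunE //.
    by rewrite lez_nat leq_subr.
  by rewrite sumr_const card_ord /B; lia.
have : exists N : nat, (B%:Z < M c + N%:Z)%R by exists (absz (B%:Z - M c)%R).+1; lia.
case=> N; elim: N c => [|N IHN] c BN.
  by apply/eqP; apply/negPn/negP => /M_bound; lia.
have [/forallP dec | /forallPn[i]] := boolP [forall i : 'I_k,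
  (c (inord i.+1) <= c (inord i))%R]; last first.
  by rewrite -ltNge => lt; rewrite -(D_adj i) IHN // M_adj; lia.
have := D_alt (c := c); rewrite (bigD1 1%g) //= big1 ?addr0 => [|s s1].
  rewrite odd_perm1 expr0 mul1r (_ : [ffun j => _] = c) => [-> // i j |]; last first.
    by apply/ffunP => j; rewrite !ffunE perm1 addrK.
  case: i => i ik; case: j => j jk /= ij; elim: j jk ij => [|j IHj] jk.
    by rewrite leqn0 => /eqP i0; rewrite (_ : Ordinal jk = Ordinal ik) //; exact/val_inj.
  rewrite leq_eqVlt => /orP[/eqP ij | ]; first by rewrite (_ : Ordinal jk = Ordinal ik) //;
    exact/val_inj.
  rewrite ltnS => /(IHj (ltnW jk)); apply: le_trans; have := dec (Ordinal (jk : j < k)).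
  have -> : inord j.+1 = Ordinal jk by apply/val_inj; rewrite /= inordK.
  by have -> : inord (Ordinal (jk : j < k)) = Ordinal (ltnW jk) by apply/val_inj;
    rewrite /= inordK // ltnW.
(* By symmetry the term of [s] may be evaluated at [c] plus [rho] minus [rho] permuted by the
   inverse of [s]; by [rho_dot_perm] its [M] is larger than that of [c]. *)
rewrite -(perm_invariant s^-1) IHN ?mulr0 //.
have sV1 : s^-1%g != 1%g by rewrite invg_eq1.
suff -> : M [ffun j => [ffun j => c (s j) + rho k (s j) - rho k j] ((s^-1)%g j)]%R =
    (M c + \sum_j (rho k j - rho k ((s^-1)%g j)) * rho k j)%R.
  by have := rho_dot_perm sV1; lia.
by rewrite /M -big_split; apply: eq_bigr => j _; rewrite !ffunE permKV /=; lia.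
Qed.

End Alternating.

(** * Inversions and changes of one entry *)

Local Open Scope fset_scope.

Lemma cell_fsetP (A B : {fset cell}) : (forall c : cell, (c \in A) = (c \in B)) -> A = B.
Proof. by move=> AB; apply/fsetP. Qed.

Lemma belowK : cancel below above.
Proof. by case=> x y; rewrite /below /above /= subrK. Qed.

Lemma aboveK : cancel above below.
Proof. by case=> x y; rewrite /below /above /= addrK. Qed.

Section Inversions.

Variable delta : diagram.
Implicit Types (T : filling delta) (c d e p : cell).

Definition inversion3 (c d e : nat) := [|| e < d < c, c <= e < d | d < c <= e].

Definition east c d := (c.2 == d.2) && (c.1 < d.1)%R.

Lemma val_at_out T c : c \notin delta -> val_at T c = 0.
Proof. by move=> cN; rewrite /val_at insubF //; apply/negbTE. Qed.

Lemma val_at_in T c : val_at T c != 0 -> c \in delta.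
Proof. by apply: contraR => /(val_at_out T) ->. Qed.

Lemma inv_ext T T' :
  (forall c d, c \in delta -> d \in delta -> east c d -> below c \in delta ->
     inversion3 (val_at T c) (val_at T d) (val_at T (below c)) =
     inversion3 (val_at T' c) (val_at T' d) (val_at T' (below c))) ->
  (forall c d, c \notin delta -> d \in delta -> east c d -> below c \in delta ->
     (val_at T (below c) < val_at T d) = (val_at T' (below c) < val_at T' d)) ->
  (forall c d, c \in delta -> d \in delta -> east c d -> below c \notin delta ->
     (val_at T d < val_at T c) = (val_at T' d < val_at T' c)) ->
  inv T = inv T'.
Proof.
move=> h3 hde hcd; rewrite /inv; congr addn; [|congr addn]; congr (#|` _|);
  apply/fsetP => -[c d];
  rewrite !inE /=; (case: (boolP (c \in delta)) => //= cD);
    (case: (boolP (d \in delta)) => //= dD).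
- have := h3 c d cD dD; rewrite /east /inversion3.
  by case: eqP => //= _; case: ltP => //= _; case: (below c \in delta) => //= ->.
- have := hde (above d) c; rewrite aboveK /east.
  by case: eqP => //= _; case: ltP => //= _; case: (above d \in delta) => //= ->.
have := hcd c d cD dD; rewrite /east.
by case: eqP => //= _; case: ltP => //= _; case: (below c \in delta) => //= ->.
Qed.

Lemma inv0P T : reflect
  [/\ forall c d, c \in delta -> d \in delta -> east c d -> below c \in delta ->
        ~~ inversion3 (val_at T c) (val_at T d) (val_at T (below c)),
      forall c d, c \notin delta -> d \in delta -> east c d -> below c \in delta ->
        val_at T d <= val_at T (below c)
    & forall c d, c \in delta -> d \in delta -> east c d -> below c \notin delta ->
        val_at T c <= val_at T d] (inv T == 0).
Proof.
rewrite /inv !addn_eq0 !cardfs_eq0; apply: (iffP and3P) =>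
  [[/eqP e1 /eqP e2 /eqP e3] | [h1 h2 h3]].
  split=> c d cD dD /andP[cd2 cd1] bD.
  - apply: contraT => /negPn i3; have : (c, d) \in inv_triples T.
      by rewrite !inE /= cD dD cd2 cd1 bD.
    by rewrite e1 inE.
  - rewrite leqNgt; apply/negP => lt; have : (d, below c) \in inv_pairs_de T.
      by rewrite !inE /= subrK belowK dD bD cd2 cd1 cD lt.
    by rewrite e2 inE.
  rewrite leqNgt; apply/negP => lt; have : (c, d) \in inv_pairs_cd T.
    by rewrite !inE /= cD dD cd2 cd1 bD lt.
  by rewrite e3 inE.
split; apply/eqP/fsetP => -[c d]; rewrite !inE /=; apply/negbTE/negP.
- by case/and5P => /andP[cD dD] c2 c1 bD; apply/negP/h1 => //; rewrite /east c2.
- case/and5P => /andP[dD eD] c2 c1 bD; have := h2 (above d) c bD dD.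
  by rewrite aboveK /east c2 c1 => /(_ isT eD); lia.
by case/and5P => /andP[cD dD] c2 c1 bD; have := h3 c d cD dD;
  rewrite /east c2 c1 => /(_ isT bD); lia.
Qed.

(** If the cell below [c] were missing, [c] and [d] would form an inversion pair; if its entry were
    less than [a] or greater than [a], the three cells would form an inversion triple. *)
Lemma inv0_above T a c d : inv T = 0 -> 0 < a -> east c d ->
  val_at T c = a.+1 -> val_at T d = a -> val_at T (below c) = a.
Proof.
move=> /eqP/inv0P[h1 _ h3] a_gt0 cd vc vd.
have cD : c \in delta by apply: (@val_at_in T); rewrite vc.
have dD : d \in delta by apply: (@val_at_in T); rewrite vd -lt0n.
have [bD|bN] := boolP (below c \in delta).
  by have := h1 c d cD dD cd bD; rewrite vc vd /inversion3; lia.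
by have := h3 c d cD dD cd bN; lia.
Qed.

(** A missing cell [c], an entry at most [a] in it or one above [a+1] would each create an inversion
    involving [d] and the cell below [c]. *)
Lemma inv0_below T a c d : inv T = 0 -> 0 < a -> east c d ->
  val_at T (below c) = a -> val_at T d = a.+1 -> val_at T c = a.+1.
Proof.
move=> /eqP/inv0P[h1 h2 _] a_gt0 cd vb vd.
have bD : below c \in delta by apply: (@val_at_in T); rewrite vb -lt0n.
have dD : d \in delta by apply: (@val_at_in T); rewrite vd.
have [cD|cN] := boolP (c \in delta).
  by have := h1 c d cD dD cd bD; rewrite vb vd /inversion3; lia.
by have := h2 c d cN dD cd bD; lia.
Qed.

Definition update T p v : filling delta := [ffun c => if val c == p then v else T c].

Lemma val_at_update T p v c : p \in delta ->
  val_at (update T p v) c = if c == p then v else val_at T c.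
Proof.
move=> pD; have [cD|cN] := boolP (c \in delta).
  by rewrite -[c]/(val [` cD]) !val_atE ffunE.
by rewrite !val_at_out //; case: eqP cN => // ->; rewrite pD.
Qed.

(* None of these conditions involves the entry of p itself, so that they can be
   used both for raising an a and for lowering an a+1 in the cell p. *)
Definition pivot T a p :=
  [/\ p \in delta,
      forall d, east p d -> val_at T d != a,
      forall c, east c p -> (val_at T c == a.+1) = (val_at T (below c) == a),
      val_at T (below p) != a
    & forall c, c.2 = (p.2 + 1)%R -> (p.1 <= c.1)%R -> val_at T c != a.+1].

Lemma eastF c : east c c = false.
Proof. by rewrite /east ltxx andbF. Qed.

Lemma below_neq c : (below c == c) = false.
Proof. by case: c => x y; rewrite /below -pair_eqE /= eqxx /=; apply/negP => /eqP; lia. Qed.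

(** Only comparisons with an entry [a] or [a+1] can change. West of [p], an [a+1] and an [a] below
    it occur together; then both comparisons with [p] change, but the triple is no inversion before
    or after. The other conditions exclude the remaining comparisons. *)
Lemma pivot_inv T a p : 0 < a -> pivot T a p ->
  inv (update T p a) = inv (update T p a.+1) /\
  Descent (update T p a) = Descent (update T p a.+1).
Proof.
move=> a_gt0 [pD noa iff_a bNa nob]; split.
  apply: inv_ext => c d cD dD cd bD; rewrite !val_at_update // ?below_neq.
  - have [cp|cNp] := eqVneq c p; have [dp|dNp] := eqVneq d p;
      have [bp|bNp] := eqVneq (below c) p; rewrite /inversion3.
    + by rewrite cp dp eastF in cd.
    + by rewrite cp dp eastF in cd.
    + by move: bp; rewrite cp => /eqP; rewrite below_neq.
    + by rewrite cp in cd *; have := noa d cd; have := bNa; lia.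
    + by move: cd bp; rewrite dp /east /below;
        case: (c) (p) => x y [x' y'] /= /andP[/eqP <- _] []; lia.
    + rewrite dp in cd; have := iff_a c cd; case: eqP => e1; case: eqP => e2 //; lia.
    + have cp : c = above p by rewrite -bp belowK.
      have := nob c; have := nob d; move: cd; rewrite cp /east /above /= => /andP[/eqP <- lt].
      by move=> /(_ erefl (ltW lt)) ? /(_ erefl (lexx _)); lia.
    + by [].
  - have cNp : c != p by apply: contraNneq cD => ->.
    have [dp|dNp] := eqVneq d p; have [bp|bNp] := eqVneq (below c) p => //.
    + have := iff_a c; rewrite -dp => /(_ cd); rewrite (val_at_out T cD); have := bD; lia.
    + have cp : c = above p by rewrite -bp belowK.
      have := nob d; move: cd; rewrite cp /east /above /= => /andP[/eqP <- lt].
      by move=> /(_ erefl (ltW lt)); lia.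
  have [cp|cNp] := eqVneq c p; have [dp|dNp] := eqVneq d p => //.
  + by rewrite cp in cd *; have := noa d cd; lia.
  + rewrite dp in cd; have := iff_a c cd; rewrite (val_at_out T bD); lia.
apply/fsetP => c; rewrite !inE /=; case: (boolP (c \in delta)) => //= cD;
  case: (boolP (below c \in delta)) => //= bD.
rewrite !val_at_update //; have [cp|cNp] := eqVneq c p;
  have [bp|bNp] := eqVneq (below c) p => //.
- by rewrite cp; have := bNa; lia.
have cp : c = above p by rewrite -bp belowK.
by have := nob c; rewrite cp /above /= => /(_ erefl (lexx _)); lia.
Qed.

(** * Finding the cell to be raised or lowered *)

Definition level T (y : int) (j : nat) : {fset cell} :=
  [fset c in delta | (c.2 == y) && (val_at T c == j)].

Lemma in_level T y j c : 0 < j -> (c \in level T y j) = (c.2 == y) && (val_at T c == j).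
Proof.
move=> j0; rewrite !inE /=; apply/andb_idl => /andP[_ /eqP e].
by apply: (@val_at_in T); rewrite e -lt0n.
Qed.

Definition rightmost T a y p :=
  [/\ p.2 = y, val_at T p = a & forall d, d.2 = y -> val_at T d = a -> (d.1 <= p.1)%R].

(** An [a+1] directly above an [a] is skipped: by the third condition of [pivot], these are the only
    [a+1] that may stand to the left of the changed cell. *)
Definition leftmost T a y p :=
  [/\ p.2 = y, val_at T p = a.+1, val_at T (below p) != a
    & forall d, d.2 = y -> val_at T d = a.+1 -> val_at T (below d) != a -> (p.1 <= d.1)%R].

Lemma pivot_update T a p v : pivot T a p -> pivot (update T p v) a p.
Proof.
case=> pD noa iff_a bNa nob; split=> //.
- by move=> d pd; rewrite val_at_update //; case: (eqVneq d p) pd => [->|_ /noa //];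
    rewrite eastF.
- move=> c cp; rewrite !val_at_update //; case: (eqVneq c p) cp => [->|_ cp];
    first by rewrite eastF.
  case: (eqVneq (below c) p) cp => [<-|_ /iff_a //]; rewrite /east /below /= => /andP[/eqP];
    lia.
- by rewrite val_at_update // below_neq.
move=> c c2 c1; rewrite val_at_update //; by case: (eqVneq c p) c2 => [-> | _ /nob ->//]; lia.
Qed.

Lemma pivot_rightmost T a p : pivot T a p -> val_at T p = a -> rightmost T a p.2 p.
Proof.
case=> pD noa iff_a bNa nob vp; split=> // d d2 vd; rewrite leNgt; apply/negP => lt.
by have := noa d; rewrite /east d2 eqxx lt vd eqxx => /(_ isT).
Qed.

Lemma pivot_leftmost T a p : pivot T a p -> val_at T p = a.+1 -> leftmost T a p.2 p.
Proof.
case=> pD noa iff_a bNa nob vp; split=> // d d2 vd vb; rewrite leNgt; apply/negP => lt.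
by have := iff_a d; rewrite /east d2 eqxx lt vd eqxx (negPf vb) => /(_ isT).
Qed.

Lemma rightmost_uniq T a y p q : rightmost T a y p -> rightmost T a y q -> p = q.
Proof.
case=> p2 vp mp [q2 vq mq]; have := mp q q2 vq; have := mq p p2 vp.
by case: p q p2 q2 {vp vq mp mq} => x y' [x' y''] /= -> -> ? ?; congr pair; lia.
Qed.

Lemma leftmost_uniq T a y p q : leftmost T a y p -> leftmost T a y q -> p = q.
Proof.
case=> p2 vp bp mp [q2 vq bq mq]; have := mp q q2 vq bq; have := mq p p2 vp bp.
by case: p q p2 q2 {vp vq mp mq bp bq} => x y' [x' y''] /= -> -> ? ?; congr pair; lia.
Qed.

Lemma cell_max (A : {fset cell}) (f : cell -> int) q : q \in A ->
  exists2 p, p \in A & forall d, d \in A -> (f d <= f p)%R.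
Proof.
move=> qA; have [p _ max_p] := @arg_maxP _ _ _ [` qA] predT (fun c : A => f (val c)) isT.
by exists (val p) => [|d dA]; [exact: valP | exact: (max_p [` dA])].
Qed.

Lemma leq_card_above (A B : {fset cell}) : (forall c : cell, c \in A -> above c \in B) ->
  #|` A| <= #|` B|.
Proof.
move=> AB; have <- : #|` [fset above c | c in A]| = #|` A| by apply: card_imfset;
  exact: can_inj aboveK.
apply: fsubset_leq_card.
by apply/fsubsetP => _ /imfsetP[c /= cA ->]; exact: AB.
Qed.

Lemma leq_card_below (A B : {fset cell}) : (forall c : cell, c \in A -> below c \in B) ->
  #|` A| <= #|` B|.
Proof.
move=> AB; have <- : #|` [fset below c | c in A]| = #|` A| by apply: card_imfset;
  exact: can_inj belowK.
apply: fsubset_leq_card.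
by apply/fsubsetP => _ /imfsetP[c /= cA ->]; exact: AB.
Qed.

(** If a condition of [pivot] failed at the rightmost [a], absence of inversions would give an
    injection between adjacent rows that contradicts one of the two counts. *)
Lemma rightmost_pivot T a y : inv T = 0 -> 0 < a ->
  #|` level T (y - 1)%R a| <= #|` level T y a.+1| ->
  #|` level T (y + 1)%R a.+1| < #|` level T y a| ->
  exists2 p, rightmost T a y p & pivot T a p.
Proof.
move=> inv0 a_gt0 le_b lt_a.
have [q qA] : exists q, q \in level T y a by apply/fset0Pn; rewrite -cardfs_gt0; lia.
have [p pA max_p] := cell_max (fun c => c.1) qA.
move: (pA); rewrite in_level // => /andP[/eqP p2 /eqP vp].
have maxp d : d.2 = y -> val_at T d = a -> (d.1 <= p.1)%R.
  by move=> d2 vd; apply: max_p; rewrite in_level // d2 vd !eqxx.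
have above_a c : east c p -> val_at T c = a.+1 -> val_at T (below c) = a.
  by move=> cp vc; exact: inv0_above cp vc vp.
(* Otherwise every [a+1] of the row lies left of [c], by [inv0_below], and hence above an [a], by
   [inv0_above]. These [a] all differ from the one below [c], against [le_b]. *)
have below_b c : c.2 = y -> (c.1 <= p.1)%R -> val_at T (below c) = a -> val_at T c = a.+1.
  move=> c2 c1 vb; apply/eqP/negPn/negP => /eqP vc.
  suff : #|` level T y a.+1| <= #|` level T (y - 1)%R a `\ below c|.
    have bA : below c \in level T (y - 1)%R a by rewrite in_level // vb /= c2 !eqxx.
    by have := cardfsD1 (below c) (level T (y - 1)%R a); rewrite bA; lia.
  apply: leq_card_below => d; rewrite in_level // => /andP[/eqP d2 /eqP vd].
  have dc : d != c by apply/eqP => dc; rewrite dc in vd.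
  have lt : (d.1 < c.1)%R.
    rewrite lt_neqAle; apply/andP; split.
      by apply: contraNneq dc => d1; rewrite -pair_eqE /= d1 d2 c2 !eqxx.
    rewrite leNgt; apply/negP => lt; apply: vc; apply: inv0_below vb vd => //.
    by rewrite /east c2 d2 eqxx.
  rewrite in_fsetD1 (can_eq belowK) dc in_level //= d2 eqxx above_a ?eqxx //.
  by rewrite /east d2 p2 eqxx (lt_le_trans lt c1).
have bNa : val_at T (below p) != a.
  by apply/eqP => /(below_b p p2 (lexx _)); rewrite vp; lia.
exists p; split=> //.
- by apply: (@val_at_in T); rewrite vp -lt0n.
- move=> d /andP[/eqP pd lt]; apply/eqP => /(maxp d); rewrite -pd p2 => /(_ erefl).
  by rewrite leNgt lt.
- move=> c cp; have /andP[/eqP c2 c1] := cp; apply/eqP/eqP => [/(above_a _ cp)//|].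
  by apply: below_b; rewrite ?c2 // ltW.
(* An [a+1] there would force an [a+1] above every [a] of row [y]. *)
move=> c c2 c1; apply/eqP => vc; move: lt_a; rewrite ltnNge => /negP[].
apply: leq_card_above => d; rewrite !in_level // => /andP[/eqP d2 /eqP vd] /=.
rewrite d2 eqxx /=; have d1 := le_trans (maxp d d2 vd) c1.
have [e|ne] := eqVneq d.1 c.1.
  by rewrite (_ : above d = c) ?vc // /above e d2 -p2 -c2; case: (c).
apply/eqP; apply: (@inv0_below T a _ c) => //; last by rewrite aboveK.
by rewrite /east /= c2 d2 p2 eqxx lt_neqAle ne.
Qed.

Lemma leftmost_pivot T a y : inv T = 0 -> 0 < a ->
  #|` level T (y - 1)%R a| < #|` level T y a.+1| ->
  #|` level T (y + 1)%R a.+1| <= #|` level T y a| ->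
  exists2 p, leftmost T a y p & pivot T a p.
Proof.
move=> inv0 a_gt0 lt_b le_a.
pose A := [fset c in level T y a.+1 | val_at T (below c) != a].
have inA c : (c \in A) = [&& c.2 == y, val_at T c == a.+1 & val_at T (below c) != a].
  by rewrite [LHS]in_fset inE in_level // andbA.
(* If every [a+1] of row [y] stood above an [a], the count [lt_b] would fail. *)
have [q qA] : exists q, q \in A.
  apply/fset0Pn/eqP => A0; move: lt_b; rewrite ltnNge => /negP[].
  apply: leq_card_below => d; rewrite !in_level // => /andP[/eqP d2 /eqP vd].
  rewrite /= d2 eqxx /=; apply/negPn/negP => vb.
  by have := inA d; rewrite A0 inE d2 vd vb !eqxx.
have [p + max_p] := cell_max (fun c => - c.1)%R qA.
rewrite inA => /and3P[/eqP p2 /eqP vp bNa].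
have minp d : d.2 = y -> val_at T d = a.+1 -> val_at T (below d) != a -> (p.1 <= d.1)%R.
  by move=> d2 vd bd; rewrite -lerN2; apply: max_p; rewrite inA d2 vd !eqxx bd.
have noa d : east p d -> val_at T d != a.
  by move=> pd; apply: contra bNa => /eqP vd; apply/eqP; exact: inv0_above pd vp vd.
exists p; split=> //.
- by apply: (@val_at_in T); rewrite vp.
- move=> c cp; have /andP[/eqP c2 c1] := cp; apply/eqP/eqP => [vc | vb].
    by apply/eqP; move: c1; apply: contraTT => vb; rewrite -leNgt minp // c2.
  exact: inv0_below cp vb vp.
(* All [a] of row [y] lie left of [p], so an [a+1] in [c] would force an [a+1] above each of them,
   all different from [c], against [le_a]. *)
move=> c c2 c1; apply/eqP => vc.
have cB : c \in level T (y + 1)%R a.+1 by rewrite in_level // c2 vc p2 !eqxx.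
suff : #|` level T y a| <= #|` level T (y + 1)%R a.+1 `\ c|.
  by have := cardfsD1 c (level T (y + 1)%R a.+1); rewrite cB; lia.
apply: leq_card_above => d; rewrite in_level // => /andP[/eqP d2 /eqP vd].
have d1 : (d.1 < p.1)%R.
  rewrite ltNge le_eqVlt; apply/negP => /orP[/eqP e | lt].
    have e' : p = d by case: (p) (d) p2 d2 e => ? ? [? ?] /= -> -> ->.
    by move: vd; rewrite -e' vp; lia.
  by have := noa d; rewrite /east p2 d2 eqxx lt vd eqxx => /(_ isT).
have lt := lt_le_trans d1 c1.
rewrite in_fsetD1 in_level //= d2 eqxx andTb; apply/andP; split.
  by apply: contraTneq lt => <-; rewrite ltxx.
apply/eqP; apply: (@inv0_below T a _ c) => //; last by rewrite aboveK.
by rewrite /east /= c2 d2 p2 eqxx.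
Qed.

End Inversions.

(** * The crystal of fillings without inversions *)

Section FillingCrystal.

Variables (delta gamma : diagram) (k : nat) (y0 : int) (h : nat).

Hypothesis rows_delta : forall c : cell, c \in delta -> (y0 <= c.2 < y0 + h%:Z)%R.

Local Notation word := {ffun delta -> 'I_k.+1}.
Implicit Types (x : word) (T : filling delta) (p c d : cell).

(** Letters run from 0 to [k], entries from 1 to [k+1], so that the value 0 of [val_at] outside the
    diagram is never an entry. *)
Definition shift x : filling delta := [ffun c => (x c : nat).+1].

Definition row (r : nat) : int := (y0 + r%:Z)%R.

Definition row_count x r j := #|` level (shift x) (row r) j.+1|.

Definition no_inv x := (inv (shift x) == 0) && (Descent (shift x) == gamma).

Definition assign x p j : word := [ffun c => if val c == p then j else x c].

Lemma shift_assign x p j : shift (assign x p j) = update (shift x) p j.+1.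
Proof. by apply/ffunP => c; rewrite !ffunE; case: eqP. Qed.

Lemma shift_inj : injective shift.
Proof.
by move=> x x' /ffunP e; apply/ffunP => c; apply/val_inj; have := e c; rewrite !ffunE => -[].
Qed.

Lemma card_level T y j : #|` level T y j| = \sum_(c : delta) (((val c).2 == y) && (T c == j)).
Proof.
rewrite card_fset_sum1 -big_fset_condE big_mkcond big_seq_fsetE.
by apply: eq_bigr => c _; rewrite val_atE; case: ifP.
Qed.

Lemma card_level_update T p v y j : p \in delta ->
  (#|` level (update T p v) y j| + ((p.2 == y) && (val_at T p == j)) =
  #|` level T y j| + ((p.2 == y) && (v == j)))%N.
Proof.
move=> pD; rewrite !card_level (bigD1 [` pD]) //= [in RHS](bigD1 [` pD]) //=.
rewrite ffunE /= eqxx -(val_atE T [` pD]) /=.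
rewrite (eq_bigr (fun c : delta => ((val c).2 == y) && (T c == j) : nat)) => [|c cp];
  first by rewrite addnC addnA [RHS]addnAC.
have /negPf cNp : val c != p by apply: contraNneq cp => e; apply/eqP/val_inj.
by rewrite ffunE cNp.
Qed.

Definition is_rightmost x i y p :=
  [&& p.2 == row y, val_at (shift x) p == i.+1 &
    [forall d : delta, ((val d).2 == row y) && (x d == i :> nat) ==> ((val d).1 <= p.1)%R]].

Definition is_leftmost x i y p :=
  [&& p.2 == row y, val_at (shift x) p == i.+2, val_at (shift x) (below p) != i.+1 &
    [forall d : delta, [&& (val d).2 == row y, x d == i.+1 :> nat
       & val_at (shift x) (below (val d)) != i.+1] ==> (p.1 <= (val d).1)%R]].

Lemma is_rightmostP x i y p :
  reflect (rightmost (shift x) i.+1 (row y) p) (is_rightmost x i y p).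
Proof.
apply: (iffP and3P) => [[/eqP p2 /eqP vp /forallP max_p] | [p2 vp max_p]]; split=> //;
  try exact/eqP.
  move=> d d2 vd; have dD : d \in delta by apply: (@val_at_in _ (shift x)); rewrite vd.
  have /implyP := max_p [` dD]; rewrite /= d2 eqxx; apply.
  by have := vd; rewrite (val_atE (shift x) [` dD]) ffunE => -[->]; rewrite eqxx.
apply/forallP => d; apply/implyP => /andP[/eqP d2 /eqP vd]; apply: max_p => //.
by rewrite val_atE ffunE vd.
Qed.

Lemma is_leftmostP x i y p : reflect (leftmost (shift x) i.+1 (row y) p) (is_leftmost x i y p).
Proof.
apply: (iffP and4P) => [[/eqP p2 /eqP vp bp /forallP max_p] | [p2 vp bp max_p]]; split=> //;
  try exact/eqP.
  move=> d d2 vd bd; have dD : d \in delta by apply: (@val_at_in _ (shift x)); rewrite vd.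
  have /implyP := max_p [` dD]; rewrite /= d2 eqxx bd andbT; apply.
  by have := vd; rewrite (val_atE (shift x) [` dD]) ffunE => -[->]; rewrite eqxx.
apply/forallP => d; apply/implyP => /and3P[/eqP d2 /eqP vd bd]; apply: max_p => //.
by rewrite val_atE ffunE vd.
Qed.

Definition raise i y x : word :=
  if [pick p : delta | is_rightmost x i y (val p)] is Some p then assign x (val p) (inord i.+1) else x.

Definition lower i y x : word :=
  if [pick p : delta | is_leftmost x i y (val p)] is Some p then assign x (val p) (inord i) else x.

Lemma raiseE x i y p :
  rightmost (shift x) i.+1 (row y) p -> raise i y x = assign x p (inord i.+1).
Proof.
move=> rp; have pD : p \in delta by case: rp => _ vp _; apply: (@val_at_in _ (shift x));
  rewrite vp.
rewrite /raise; case: pickP => [q /is_rightmostP rq | /(_ [` pD])/is_rightmostP//].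
by rewrite (rightmost_uniq rp rq).
Qed.

Lemma lowerE x i y p : leftmost (shift x) i.+1 (row y) p -> lower i y x = assign x p (inord i).
Proof.
move=> rp; have pD : p \in delta by case: rp => _ vp _ _; apply: (@val_at_in _ (shift x));
  rewrite vp.
rewrite /lower; case: pickP => [q /is_leftmostP rq | /(_ [` pD])/is_leftmostP//].
by rewrite (leftmost_uniq rp rq).
Qed.

Lemma row_count_height x r j : h <= r -> row_count x r j = 0.
Proof.
move=> hr; apply/eqP; rewrite cardfs_eq0; apply/eqP; apply: cell_fsetP => c;
  rewrite in_level // inE.
apply/negbTE/negP => /andP[/eqP c2 /eqP vc].
have /rows_delta : c \in delta by apply: (@val_at_in _ (shift x)); rewrite vc.
by rewrite c2 /row; lia.
Qed.

Lemma prev_row_count x i y : prev_cnt row_count x i y = #|` level (shift x) (row y - 1)%R i.+1|.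
Proof.
case: y => [|r] /=; last by rewrite /row_count /row; congr (#|` level _ _ _|); lia.
apply/esym/eqP; rewrite cardfs_eq0; apply/eqP; apply: cell_fsetP => c; rewrite in_level // inE.
apply/negbTE/negP => /andP[/eqP c2 /eqP vc].
have /rows_delta : c \in delta by apply: (@val_at_in _ (shift x)); rewrite vc.
by rewrite c2 /row; lia.
Qed.

Lemma next_row_count x i y : row_count x y.+1 i.+1 = #|` level (shift x) (row y + 1)%R i.+2|.
Proof. by rewrite /row_count /row; congr (#|` level _ _ _|); lia. Qed.

Lemma row_eq r y : (row y == row r) = (r == y).
Proof. by rewrite /row; lia. Qed.

Lemma moved_assign x i y p : i < k -> p \in delta -> p.2 = row y ->
  val_at (shift x) p = i.+1 -> moved row_count i y x (assign x p (inord i.+1)).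
Proof.
move=> ik pD p2 vp r j; rewrite /row_count shift_assign inordK ?ltnS //.
have := card_level_update (shift x) i.+2 (row r) j.+1 pD.
by rewrite p2 vp row_eq !eqSS ![_ == j]eq_sym.
Qed.

Lemma update_id T p : update T p (val_at T p) = T.
Proof. by apply/ffunP => c; rewrite ffunE; case: eqP => // <-; rewrite val_atE. Qed.

Lemma update_update T p v w : update (update T p v) p w = update T p w.
Proof. by apply/ffunP => c; rewrite !ffunE; case: eqP. Qed.

Lemma no_inv_pivot x x' i p : pivot (shift x) i.+1 p ->
  shift x = update (shift x) p i.+1 -> shift x' = update (shift x) p i.+2 ->
  no_inv x = no_inv x'.
Proof.
move=> pv e e'; have [] := pivot_inv (ltn0Sn i) pv.
by rewrite -e -e' /no_inv => -> ->.
Qed.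

(** The conditions of [pivot] survive the change of entry, and they make the raised cell the one
    that [lower] selects. *)
Lemma raiseP i y x : i < k -> y < h -> no_inv x ->
  prev_cnt row_count x i y <= row_count x y i.+1 -> row_count x y.+1 i.+1 < row_count x y i ->
  [/\ no_inv (raise i y x), moved row_count i y x (raise i y x) & lower i y (raise i y x) = x].
Proof.
move=> ik yh nx; rewrite prev_row_count next_row_count => le_b lt_a.
have inv0 : inv (shift x) = 0 by case/andP: nx => /eqP.
have [p rp pv] := rightmost_pivot inv0 (ltn0Sn i) le_b lt_a.
have [pD _ _ _ _] := pv; have [p2 vp _] := rp.
rewrite (raiseE rp); set x' := assign _ _ _.
have e' : shift x' = update (shift x) p i.+2 by rewrite shift_assign inordK ?ltnS.
split; last 1 first.
- have lp : leftmost (shift x') i.+1 (row y) p.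
    rewrite -p2; apply: pivot_leftmost; first by rewrite e'; exact: pivot_update.
    by rewrite e' val_at_update // eqxx.
  rewrite (lowerE lp); apply: shift_inj.
  rewrite shift_assign e' update_update inordK; last exact: ltnW.
  by rewrite -vp update_id.
- by rewrite -(no_inv_pivot pv _ e') // -vp update_id.
exact: moved_assign.
Qed.

Lemma lowerP i y x : i < k -> y < h -> no_inv x ->
  prev_cnt row_count x i y < row_count x y i.+1 -> row_count x y.+1 i.+1 <= row_count x y i ->
  [/\ no_inv (lower i y x), moved row_count i y (lower i y x) x & raise i y (lower i y x) = x].
Proof.
move=> ik yh nx; rewrite prev_row_count next_row_count => lt_b le_a.
have inv0 : inv (shift x) = 0 by case/andP: nx => /eqP.
have [p lp pv] := leftmost_pivot inv0 (ltn0Sn i) lt_b le_a.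
have [pD _ _ _ _] := pv; have [p2 vp _ _] := lp.
rewrite (lowerE lp); set x' := assign _ _ _.
have e' : shift x' = update (shift x) p i.+1 by rewrite shift_assign inordK // ltnW.
have pv' : pivot (shift x') i.+1 p by rewrite e'; exact: pivot_update.
have vp' : val_at (shift x') p = i.+1 by rewrite e' val_at_update // eqxx.
have back : assign x' p (inord i.+1) = x.
  by apply: shift_inj; rewrite shift_assign e' update_update inordK ?ltnS // -vp update_id.
split; last 1 first.
- by rewrite (@raiseE _ _ _ p) // -p2; exact: pivot_rightmost.
- rewrite (@no_inv_pivot x' x i p) //; first by rewrite -vp' update_id.
  by rewrite e' update_update -vp update_id.
by have := moved_assign ik pD p2 vp'; rewrite back.
Qed.

End FillingCrystal.

(** * Jamming and row counts *)

Section Jamming.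

Variables (delta : diagram) (T : filling delta).
Implicit Types (c d e p q : cell) (i y : nat).

Local Notation v := (val_at T).

Definition ballot (w : seq nat) :=
  forall n i, 0 < i -> count_mem i.+1 (drop n w) <= count_mem i (drop n w).

Definition after i c : {fset cell} := [fset d in delta | row_reading c d && (v d == i)].

Definition lower_rows i (y : int) : {fset cell} :=
  [fset d in delta | (d.2 < y)%R && (v d == i)].

(** The ballot condition for the word with sorted rows; [goodP] identifies it with the highest
    weight condition. *)
Definition row_ballot := forall i (y : int), 0 < i ->
  #|` lower_rows i.+1 (y + 1)%R| <= #|` lower_rows i y|.

Lemma in_after i c d : 0 < i -> (d \in after i c) = row_reading c d && (v d == i).
Proof.
move=> i0; rewrite !inE /=; apply/andb_idl => /andP[_ /eqP e].
by apply: (@val_at_in _ T); rewrite e -lt0n.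
Qed.

Lemma mem_after i c : 0 < i -> v c = i -> c \in after i c.
Proof. by move=> i0 vc; rewrite in_after // vc /row_reading !eqxx lexx orbT. Qed.

Lemma in_lower_rows i (y : int) d : 0 < i -> (d \in lower_rows i y) = (d.2 < y)%R && (v d == i).
Proof.
move=> i0; rewrite !inE /=; apply/andb_idl => /andP[_ /eqP e].
by apply: (@val_at_in _ T); rewrite e -lt0n.
Qed.

Lemma count_reading (P : pred cell) : count P (reading delta) = #|` [fset d in delta | P d]|.
Proof.
rewrite -size_filter; apply/perm_size/uniq_perm;
  rewrite ?filter_uniq ?reading_uniq ?fset_uniq //.
by move=> d; rewrite mem_filter mem_reading !inE /= andbC.
Qed.

Lemma drop_sorted (s : seq cell) c : sorted row_reading s -> uniq s -> c \in s ->
  drop (index c s) s = filter (row_reading c) s.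
Proof.
elim: s => //= d s IHs path_s /andP[ds us]; rewrite inE.
have min_d : all (row_reading d) s := order_path_min row_reading_trans path_s.
have refl e : row_reading e e by rewrite /row_reading eqxx lexx orbT.
case: eqVneq => [-> _ | cd cs /=].
  by rewrite drop0 refl; congr cons; apply/esym/all_filterP.
rewrite IHs ?(path_sorted path_s) //; case: ifP => // cd'.
have dc := allP min_d _ cs; case/eqP: cd; apply: row_reading_anti.
by rewrite cd' dc.
Qed.

Lemma count_drop i c : c \in delta ->
  count_mem i (drop (index c (reading delta)) (rw T)) = #|` after i c|.
Proof.
move=> cD; rewrite -map_drop drop_sorted ?reading_sorted ?reading_uniq ?mem_reading //.
rewrite count_map count_filter count_reading; congr #|` _|; apply/fsetP => d.
by rewrite !inE /= (andbC (_ == _)).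
Qed.

Lemma size_rw : size (rw T) = #|` delta|.
Proof. by rewrite size_map size_reading. Qed.

Lemma nth_rw c : c \in delta -> nth 0 (rw T) (index c (reading delta)) = v c.
Proof. by move=> cD; rewrite (nth_map c) ?index_mem ?mem_reading // nth_index ?mem_reading. Qed.

Lemma index_lt c : c \in delta -> index c (reading delta) < #|` delta|.
Proof. by move=> cD; rewrite -size_reading index_mem mem_reading. Qed.

Lemma cell_of_index n : n < #|` delta| -> exists2 c, c \in delta & n = index c (reading delta).
Proof.
move=> nD; exists (nth (0, 0)%R (reading delta) n).
  by rewrite -mem_reading mem_nth // size_reading.
by rewrite index_uniq ?size_reading ?reading_uniq.
Qed.

Lemma ballotP : ballot (rw T) <->
  forall c i, c \in delta -> 0 < i -> #|` after i.+1 c| <= #|` after i c|.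
Proof.
split=> [bT c i cD i0 | bT n i i0]; first by rewrite -!count_drop //; exact: bT.
have [nD | ] := ltnP n #|` delta|; last by rewrite -size_rw => /drop_oversize ->.
by have [c cD ->] := cell_of_index nD; rewrite !count_drop //; exact: bT.
Qed.

Lemma pistoledP c d : c \in delta -> d \in delta ->
  reflect (exists b, [/\ b \in delta, c \in pistol delta b & d \in pistol delta b])
    (pistoled delta [:: index c (reading delta); index d (reading delta)]).
Proof.
move=> cD dD; rewrite /pistoled /= !index_lt //= !nth_index ?mem_reading //.
apply: (iffP existsP) => [[b /and3P[cb db _]] | [b [bD cb db]]]; first by exists (val b);
  split=> //; exact: valP.
by exists [` bD]; rewrite /= cb db.
Qed.

Lemma cell_jamsP : reflect
  (exists p q, [/\ p \in delta, q \in delta, v q = (v p).+1,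
    #|` after (v q) q| = #|` after (v p) p|.+1
     & exists b, [/\ b \in delta, p \in pistol delta b & q \in pistol delta b]])
  (jams delta (rw T)).
Proof.
apply: (iffP (jamsP _ _)).
  move=> [i [j [m [n [/and3P[mD /eqP vm /eqP cm] /and3P[nD /eqP vn /eqP cn] mn]]]]].
  rewrite size_rw in mD nD.
  have [p pD em] := cell_of_index mD; have [q qD en] := cell_of_index nD.
  move: vm cm vn cn mn; rewrite em en !nth_rw // !count_drop // => vp cp vq cq /pistoledP.
  by move=> mn; exists p, q; rewrite vp vq cp cq; split=> //; exact: mn.
move=> [p [q [pD qD vq cq pq]]].
exists (v p), #|` after (v p) p|, (index p (reading delta)), (index q (reading delta)).
rewrite /from_last size_rw !index_lt // !nth_rw // !count_drop // -vq cq !eqxx; split=> //.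
exact/pistoledP.
Qed.

Lemma leq_card_after i c d : row_reading c d -> #|` after i d| <= #|` after i c|.
Proof.
move=> cd; apply/fsubset_leq_card/fsubsetP => e; rewrite !inE /= => /and3P[-> de ->].
by rewrite (row_reading_trans cd de).
Qed.

Lemma ltn_card_after i c d : 0 < i -> v c = i -> row_reading c d -> c != d ->
  #|` after i d| < #|` after i c|.
Proof.
move=> i0 vc cd ne; have cA := mem_after i0 vc.
rewrite [X in _ < X](cardfsD1 c) cA add1n ltnS; apply/fsubset_leq_card/fsubsetP => e.
rewrite in_fsetD1 !in_after // => /andP[de ->]; rewrite (row_reading_trans cd de) !andbT.
apply: contra ne => /eqP e_c; rewrite e_c in de; apply/eqP; apply: row_reading_anti.
by rewrite cd de.
Qed.

Lemma nth_from_last i s : 0 < i -> 0 < s <= #|` [fset d in delta | v d == i]| ->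
  exists2 q, v q = i & #|` after i q| = s.
Proof.
move=> i0 /andP[s0]; rewrite -count_reading => sT.
have [n [nT vn cn]] : exists n, [/\ n < size (rw T),
  nth 0 (rw T) n = i & count_mem i (drop n (rw T)) = s].
  move: sT; rewrite -(count_map v (pred1 i)) -/(rw T).
  elim: (rw T) => [|a w IHw] /=; first by rewrite leqn0 => /eqP e; rewrite e in s0.
  case: (eqVneq a i) => [-> /= | ne /=]; last by move=> /IHw[n [nT vn cn]]; exists n.+1.
  rewrite leq_eqVlt => /orP[/eqP -> | lt]; first by exists 0; rewrite /= eqxx.
  by have [n [nT vn cn]] := IHw lt; exists n.+1.
rewrite size_rw in nT; have [q qD en] := cell_of_index nT; exists q.
  by rewrite -nth_rw // -en.
by rewrite -count_drop // -en.
Qed.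

(** Let [q] be a highest [i+1] weakly after [c]. All [i+1] after [c] lie in rows up to that of [q],
    while the rows below [q] lie entirely after [c]. *)
Lemma row_ballot_ballot : row_ballot -> ballot (rw T).
Proof.
move=> rb; apply/ballotP => c i cD i0.
have [-> | /fset0Pn[q0 q0A]] := eqVneq (after i.+1 c) fset0; first by rewrite cardfs0.
have [q qA max_q] := cell_max (fun d => d.2) q0A.
apply: leq_trans (leq_trans (rb i q.2 i0) _); apply/fsubset_leq_card/fsubsetP => d.
  move=> dA; move: (max_q d dA); move: dA; rewrite in_after // in_lower_rows // => /andP[_ ->].
  by rewrite andbT /= => ?; lia.
move: qA; rewrite in_lower_rows // !in_after // => /andP[cq _] /andP[dq ->]; rewrite andbT.
by move: cq; rewrite /row_reading => /orP[lt | /andP[/eqP -> _]]; rewrite ?dq // (lt_trans dq).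
Qed.

Hypothesis inv0 : inv T = 0.

(** Weakly after [q] there is one more [i+1] than there are [i] weakly after [p]. Whether [p] lies
    in the row of [q] or in the next lower one, this surplus survives in the count by whole rows. *)
Lemma row_ballot_jams : (forall c,
  c \in delta -> 0 < v c) -> row_ballot -> ~~ jams delta (rw T).
Proof.
move=> pos rb; have /ballotP bT := row_ballot_ballot rb.
apply/cell_jamsP => -[p [q [pD qD vq cq [b [bD]]]]].
set i := v p in vq cq; have i0 : 0 < i by exact: pos.
rewrite !inE /= => /and3P[_ bp pb] /and3P[_ bq qb].
have qp : ~~ row_reading p q.
  by apply/negP => /(leq_card_after i); have := bT q i qD i0; rewrite -vq cq; lia.
have {}qp : row_reading q p by have := row_reading_total p q; rewrite (negPf qp).
have [y2 | y2] := eqVneq p.2 q.2.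
  have := rb i q.2 i0.
  have : #|` after i.+1 q| <= #|` lower_rows i.+1 (q.2 + 1)%R|.
    apply/fsubset_leq_card/fsubsetP => d; rewrite in_after // in_lower_rows // => /andP[+ ->].
    by rewrite /row_reading andbT => /orP[|/andP[/eqP -> _]]; lia.
  have : #|` lower_rows i q.2| <= #|` after i p `\ p|.
    apply/fsubset_leq_card/fsubsetP => d; rewrite in_fsetD1 in_after // in_lower_rows //.
    case/andP=> dq ->; rewrite /row_reading y2 dq !andbT /=.
    by apply: contraTneq dq => ->; rewrite y2 ltxx.
  have := cardfsD1 p (after i p); rewrite mem_after //.
  by move: cq; rewrite vq; lia.
have [p2 q2 pq1] : [/\ p.2 = (b.2 - 1)%R, q.2 = b.2 & (p.1 <= q.1)%R].
  by move: bp pb bq qb qp y2; rewrite /row_reading /below /=; split; lia.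
(* Counting by whole rows adds at most the [i] in [L] on one side, and the [i+1] in [L'] on the
   other. As [q] is to the east, every cell of [L] has an [i+1] above it, so the added [i] are
   outnumbered or balanced. *)
pose L := [fset d in delta | [&& d.2 == p.2, (d.1 < p.1)%R & v d == i]].
have inL d : (d \in L) = [&& d.2 == p.2, (d.1 < p.1)%R & v d == i].
  rewrite !inE /=; apply/andb_idl => /and3P[_ _ /eqP e].
  by apply: (@val_at_in _ T); rewrite e -lt0n.
have h1 : #|` lower_rows i q.2| <= #|` after i p| + #|` L|.
  rewrite -cardfsUI; apply: leq_trans (leq_addr _ _); apply/fsubset_leq_card/fsubsetP => d.
  rewrite in_lower_rows // in_fsetU in_after // inL => /andP[dq ->]; rewrite !andbT.
  by rewrite /row_reading; lia.
pose L' := [fset d in lower_rows i.+1 (q.2 + 1)%R | (d.2 == q.2) && (d.1 < p.1)%R].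
have inL' d : (d \in L') = ((d.2 < q.2 +
  1)%R && (v d == i.+1)) && ((d.2 == q.2) && (d.1 < p.1)%R).
  by rewrite [LHS]in_fset inE in_lower_rows.
have h2 : #|` L| <= #|` L'|.
  apply: leq_card_above => d; rewrite inL => /and3P[/eqP d2 d1 /eqP vd].
  rewrite inL' /= d2 d1 p2 q2 subrK eqxx !andbT.
  apply/andP; split; first by lia.
  apply/eqP; apply: (@inv0_below _ T i _ q) => //; last by rewrite aboveK.
  by rewrite /east /=; lia.
have h3 : #|` after i.+1 q| + #|` L'| <= #|` lower_rows i.+1 (q.2 + 1)%R|.
  rewrite -cardfsUI [X in (_ + X)%N](_ : _ = 0) ?addn0.
    apply/fsubset_leq_card/fsubsetP => d; rewrite in_fsetU in_after // inL' in_lower_rows //.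
    case/orP => [/andP[+ ->] | /andP[//]]; rewrite /row_reading; lia.
  apply/eqP; rewrite cardfs_eq0; apply/eqP/fsetP => d; rewrite in_fsetI in_after // inL' inE.
  by apply/negbTE; rewrite /row_reading; lia.
by have := rb i q.2 i0; move: cq; rewrite vq; lia.
Qed.

(** A failure at row [y] yields an [i+1] in that row with an [i] to its east. Absence of inversions
    puts an [i] below this [i+1], and that [i] takes part in a jam within the pistol starting
    there. *)
Lemma ballot_row_ballot : ballot (rw T) -> ~~ jams delta (rw T) -> row_ballot.
Proof.
move=> /ballotP bT /cell_jamsP nojam i y i0; rewrite leqNgt; apply/negP => lt.
set s := #|` lower_rows i y| in lt.
have tot : #|` lower_rows i.+1 (y + 1)%R| <= #|` [fset d in delta | v d == i.+1]|.
  by apply/fsubset_leq_card/fsubsetP => d; rewrite !inE /= => /and3P[-> _ ->].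
have [q vq cq] : exists2 q : cell, v q = i.+1 & #|` after i.+1 q| = s.+1.
  by apply: nth_from_last; rewrite //= (leq_trans lt tot).
have qD : q \in delta by apply: (@val_at_in _ T); rewrite vq.
have qy : (q.2 <= y)%R.
  rewrite leNgt; apply/negP => yq; move: lt; rewrite ltnNge => /negP[].
  have := cardfsD1 q (after i.+1 q); rewrite mem_after // cq => -[->].
  apply/fsubset_leq_card/fsubsetP => d; rewrite in_fsetD1 in_after // in_lower_rows //.
  case/andP => dy ->; rewrite andbT /row_reading; apply/andP; split; last by lia.
  by apply: contraTneq dy => ->; lia.
(* The ballot condition gives at least [s+1] letters [i] after [q], but only [s] of them lie below
   row [y]. *)
have [d dA dN] : exists2 d : cell, d \in after i q & d \notin lower_rows i y.
  apply/fsubsetPn; apply/negP => /fsubset_leq_card; have := bT q i qD i0; rewrite cq -/s; lia.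
move: dA dN; rewrite in_after // in_lower_rows // => /andP[qd /eqP vd];
  rewrite vd eqxx andbT -leNgt => yd.
have q2 : q.2 = y by move: qd; rewrite /row_reading; lia.
have qd_east : east q d.
  have : d.1 != q.1 \/ d.2 != q.2.
    have [e1|] := eqVneq d.1 q.1; last by left.
    have [e2|] := eqVneq d.2 q.2; last by right.
    have e : d = q by case: (d) (q) e1 e2 => ? ? [? ?] /= -> ->.
    by move: vd; rewrite e vq; lia.
  by move: qd; rewrite /row_reading /east; lia.
have ve : v (below q) = i := inv0_above inv0 i0 qd_east vq vd.
set e := below q in ve; have eD : e \in delta by apply: (@val_at_in _ T); rewrite ve -lt0n.
set t := #|` after i e|.
have ts : t <= s.
  apply/fsubset_leq_card/fsubsetP => c; rewrite in_after // in_lower_rows // => /andP[+ ->].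
  by rewrite /row_reading /e /below /= q2; lia.
(* As [e] is the [t]-th from last [i], its partner in the jam is the [(t+1)]-th from last [i+1]. It
   is weakly after [q] because [t <= s], and before [e] by the ballot condition. *)
have [q' vq' cq'] : exists2 q : cell, v q = i.+1 & #|` after i.+1 q| = t.+1.
  by apply: nth_from_last; rewrite //= (leq_trans _ (leq_trans lt tot)).
have q'D : q' \in delta by apply: (@val_at_in _ T); rewrite vq'.
have qq' : row_reading q q'.
  have := row_reading_total q q'; case: (eqVneq q' q) => [-> | ne]; first by rewrite orbb.
  case/orP => // q'q; have := ltn_card_after (ltn0Sn i) vq' q'q ne; lia.
have q'e : row_reading q' e.
  have := row_reading_total q' e; case/orP => // /(leq_card_after i).
  by have := bT q' i q'D i0; rewrite cq' -/t; lia.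
case: nojam; exists e, q'; split=> //; rewrite ?ve ?vq' //.
exists q; rewrite /pistol !inE /= eD q'D qD q'e qq' -/e; split=> //;
  rewrite /row_reading /e /below /=; lia.
Qed.

End Jamming.

(** * Contents and highest weight fillings *)

Section Letters.

Variables (delta gamma : diagram) (k : nat).
Implicit Types x : {ffun delta -> 'I_k.+1}.

Definition letters x : {ffun 'I_k.+1 -> int} := [ffun j => Posz #|[pred c | x c == j]|].

Definition fillings (c : {ffun 'I_k.+1 -> int}) :=
  #|[pred x : {ffun delta -> 'I_k.+1} | no_inv gamma x && (letters x == c)]|.

Definition unjammed_fillings la := #|[pred x : {ffun delta -> 'I_k.+1} | [&& no_inv gamma x,
  yamanouchi la (rw (shift x)) & ~~ jams delta (rw (shift x))]]|.

Lemma shift_gt0 x c : c \in delta -> 0 < val_at (shift x) c.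
Proof. by move=> cD; rewrite -[c]/(val [` cD]) val_atE ffunE. Qed.

Lemma shift_le x c : val_at (shift x) c <= k.+1.
Proof.
have [cD|cN] := boolP (c \in delta); last by rewrite val_at_out.
by rewrite -[c]/(val [` cD]) val_atE ffunE.
Qed.

Lemma count_rw x (j : 'I_k.+1) : Posz (count_mem j.+1 (rw (shift x))) = letters x j.
Proof.
rewrite ffunE count_map count_reading card_fset_sum1 -big_fset_condE big_seq_fsetE -sum1_card.
by congr Posz; apply: eq_bigl => c; rewrite !inE val_atE ffunE.
Qed.

End Letters.

Section BoundedRows.

Variables (delta gamma : diagram) (k : nat) (y0 : int) (h : nat).

Hypothesis rows_delta : forall c : cell, c \in delta -> (y0 <= c.2 < y0 + h%:Z)%R.

Implicit Types (x : {ffun delta -> 'I_k.+1}) (c : {ffun 'I_k.+1 -> int}).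

Local Notation cnt := (@row_count delta k y0).

Lemma cum_lower_rows x j y : cum cnt x j y = #|` lower_rows (shift x) j.+1 (row y0 y)|.
Proof.
elim: y => [|y IHy].
  rewrite cum0; apply/esym/eqP; rewrite cardfs_eq0; apply/eqP; apply: cell_fsetP => c.
  rewrite !inE /=; apply/negbTE/negP => /and3P[/rows_delta + + _]; rewrite /row; lia.
rewrite cumS IHy -[RHS](cardfsID (level (shift x) (row y0 y) j.+1)).
rewrite addnC /row_count; congr addn; congr #|` _|; apply: cell_fsetP => c.
  rewrite in_fsetI in_lower_rows // in_level // /row; lia.
rewrite in_fsetD !in_lower_rows // in_level // /row; lia.
Qed.

Lemma goodP x : reflect (row_ballot (shift x)) (good k h cnt x).
Proof.
have exE (i : 'I_k) y : excess cnt i x y = ((#|` lower_rows (shift x) i.+2 (row y0 y + 1)%R|)%:Z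
   - (#|` lower_rows (shift x) i.+1 (row y0 y)|)%:Z)%R.
  rewrite /excess !cum_lower_rows (_ : row y0 y.+1 = row y0 y + 1)%R //; rewrite /row; lia.
apply: (iffP forallP) => [gx i y i0 | rb y]; last first.
  by apply/forallP => i; rewrite exE; have := rb i.+1 (row y0 y) (ltn0Sn i); lia.
have [ik|ki] := leqP i k; last first.
  rewrite [X in X <= _](_ : _ = 0) //; apply/eqP; rewrite cardfs_eq0; apply/eqP;
    apply: cell_fsetP => c.
  by rewrite in_lower_rows // inE; have := shift_le x c; lia.
have [yy|yy] := leP y0 y; last first.
  rewrite [X in X <= _](_ : _ = 0) //; apply/eqP; rewrite cardfs_eq0; apply/eqP;
    apply: cell_fsetP => c.
  rewrite !inE; apply/negbTE/negP => /= /and3P[/rows_delta]; lia.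
(* Rows beyond the diagram are replaced by row [h], which does not change the sets being counted. *)
pose r := minn h (absz (y - y0)%R).
have rh : r < h.+1 by rewrite ltnS geq_minl.
have ik1 : i.-1 < k by case: (i) i0 ik.
have := gx (Ordinal rh) => /forallP/(_ (Ordinal ik1)); rewrite exE /= prednK // => ineq.
have -> : lower_rows (shift x) i y = lower_rows (shift x) i (row y0 r).
  apply: cell_fsetP => c; rewrite !inE; case: (boolP (c \in delta)) => //= /rows_delta;
    rewrite /row; lia.
have -> : lower_rows (shift x) i.+1 (y + 1) = lower_rows (shift x) i.+1 (row y0 r + 1)%R.
  apply: cell_fsetP => c; rewrite !inE; case: (boolP (c \in delta)) => //= /rows_delta;
    rewrite /row; lia.
by move: ineq; lia.
Qed.

Lemma good_ballot x : no_inv gamma x ->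
  good k h cnt x <-> ballot (rw (shift x)) /\ ~~ jams delta (rw (shift x)).
Proof.
case/andP => /eqP inv0 _; split=> [/goodP rb | [b nj]].
  split; first exact: row_ballot_ballot.
  by apply: row_ballot_jams => // c cD; exact: shift_gt0.
by apply/goodP; exact: ballot_row_ballot.
Qed.

Lemma content_letters x : content k h cnt x = letters x.
Proof.
apply/ffunP => j; rewrite -count_rw ffunE /wt cum_lower_rows count_map count_reading.
congr (Posz #|` _|); apply: cell_fsetP => c; rewrite !inE /=.
by case: (boolP (c \in delta)) => //= /rows_delta/andP[_ ->].
Qed.

Lemma fillings_weights c : fillings delta gamma c = weights (@no_inv delta gamma k) h cnt c.
Proof. by apply: eq_card => x; rewrite !inE content_letters. Qed.

Lemma fillings_adj i c : fillings delta gamma [ffun j => c (adj i j)] = fillings delta gamma c.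
Proof.
rewrite !fillings_weights; apply: weights_adj.
- exact: row_count_height.
- exact: raiseP.
- exact: lowerP.
Qed.

Lemma fillings_alternating c :
  (forall i j : 'I_k.+1, i <= j -> (c j <= c i)%R) ->
  (\sum_(s : 'S_k.+1) (-1) ^+ s *
     (fillings delta gamma [ffun j => c (s j) + rho k (s j) - rho k j])%:Z
   = (highest_weights (@no_inv delta gamma k) h cnt c)%:Z)%R.
Proof.
move=> dec_c.
rewrite -(@weights_alternating _ _ k h cnt (@raise _ _ y0) (@lower _ _ y0)) //.
- by apply: eq_bigr => s _; rewrite fillings_weights.
- exact: row_count_height.
- exact: raiseP.
- exact: lowerP.
Qed.

Definition partition_content (la : seq nat) : {ffun 'I_k.+1 -> int} := [ffun j =>
  Posz (nth 0 la (val j))].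

Lemma highest_weights_partition la : size la <= k.+1 ->
  highest_weights (@no_inv delta gamma k) h cnt (partition_content la) =
  unjammed_fillings delta gamma k la.
Proof.
move=> sz_la; apply: eq_card => x; rewrite !inE; case: (boolP (no_inv gamma x)) => //= nx.
have [gb bg] := good_ballot nx; rewrite content_letters.
apply/andP/andP => [[/gb[b nj] /eqP ex] | [/yamanouchiP[w0 cw b] nj]].
  split=> //; apply/yamanouchiP; split=> // [|i i0].
    apply/negP => /mapP[c]; rewrite mem_reading => /(shift_gt0 x); lia.
  have [ik|ki] := leqP i k.+1; last first.
    rewrite nth_default; last by apply: leq_trans sz_la _; rewrite -ltnS prednK.
    apply/count_memPn/negP => /mapP[c _ e]; have := shift_le x c; lia.
  have ik1 : i.-1 < k.+1 by case: (i) i0 ik.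
  have := count_rw x (Ordinal ik1); rewrite ex ffunE /= prednK //; lia.
split; first by apply: bg.
by apply/eqP/ffunP => j; rewrite -count_rw ffunE cw.
Qed.

End BoundedRows.

(** * Young diagrams and tableaux *)

Lemma rows_bounded (delta : diagram) : exists y0 h, forall c : cell, c \in delta ->
  (y0 <= c.2 < y0 + h%:Z)%R.
Proof.
pose B := \sum_(c <- delta) absz c.2.
exists (- B%:Z)%R, (B + B).+1 => c cD.
have : absz c.2 <= B by rewrite /B (big_fsetD1 c) //= leq_addr.
lia.
Qed.

Section YoungDiagram.

Variable la : seq nat.
(** Coordinates are exchanged, since [young] uses (row, column); row 0 becomes the bottom row. *)
Definition young_diagram : diagram := [fset ((Posz p.2, Posz p.1) : cell) | p in young la].

Definition upper_cells : diagram := [fset c in young_diagram | (0 < c.2)%R].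

Lemma mem_young_diagram (c : cell) : (c \in young_diagram) =
  [&& (0 <= c.1)%R, (0 <= c.2)%R & absz c.1 < nth 0 la (absz c.2)].
Proof.
apply/imfsetP/and3P => [[[r s] /=] | [c1 c2 lt]].
  by rewrite mem_young => lt ->.
exists (absz c.2, absz c.1); rewrite /= ?mem_young //.
by case: c c1 c2 {lt} => x y /= *; congr pair; lia.
Qed.

Lemma young_diagram_left (c d : cell) :
  d \in young_diagram -> c.2 = d.2 -> (0 <= c.1 <= d.1)%R ->
  c \in young_diagram.
Proof.
rewrite !mem_young_diagram /= => /and3P[d1 d2 lt] -> /andP[c1 le]; rewrite c1 d2 /=.
by apply: leq_ltn_trans lt; lia.
Qed.

Lemma card_young_row (j : nat) :
  #|` [fset c in young_diagram | c.2 == j%:Z%R]| = nth 0 la j.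
Proof.
rewrite -[RHS](size_iota 0) -(size_map (fun i => (Posz i, Posz j) : cell)).
apply/perm_size/uniq_perm; rewrite ?fset_uniq ?map_inj_uniq ?iota_uniq //;
  first by move=> i i' [].
move=> c; rewrite in_fset inE mem_young_diagram.
apply/andP/mapP => [[/and3P[c1 c2 lt] /eqP e] | [i]].
  exists (absz c.1); first by rewrite /= mem_iota add0n /= -(absz_nat j) -e.
  by case: (c) c1 e => x y /= c1 ->; congr pair; lia.
by rewrite mem_iota add0n => /= lt ->.
Qed.

Hypothesis la_sorted : sorted geq la.

Lemma nth_partition i j : i <= j -> nth 0 la j <= nth 0 la i.
Proof.
move=> ij; have [jl|] := ltnP j (size la); last by move/(nth_default 0) ->.
have geq_trans : transitive geq by move=> a b c /= ba ac; exact: leq_trans ac ba.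
by apply: (sorted_leq_nth geq_trans leqnn 0 la_sorted); rewrite ?inE // (leq_ltn_trans ij).
Qed.

Lemma young_diagram_below (c : cell) :
  c \in young_diagram -> (0 < c.2)%R -> below c \in young_diagram.
Proof.
rewrite !mem_young_diagram /= => /and3P[-> c2 lt] pos; apply/andP; split=> //.
apply/andP; split; first by lia.
by apply: leq_trans lt _; apply: nth_partition; lia.
Qed.

Definition tableau (T : filling young_diagram) :=
  (forall c d : cell,
    c \in young_diagram -> d \in young_diagram -> c.2 = d.2 -> (c.1 <= d.1)%R ->
     val_at T c <= val_at T d) /\
  (forall c d : cell,
    c \in young_diagram -> d \in young_diagram -> c.1 = d.1 -> (c.2 < d.2)%R ->
     val_at T c < val_at T d).

(** Descents at all upper cells amount to strict columns. Rows are treated by induction upwards: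
    inversion pairs settle the bottom row, and higher up the entry below [c] is at most the one
    below [d], hence less than that of [d], so only a weak increase from [c] to [d] avoids an
    inversion triple. *)
Lemma tableauP (T : filling young_diagram) :
  (inv T == 0) && (Descent T == upper_cells) <-> tableau T.
Proof.
split=> [/andP[/inv0P[h3 _ hcd] /eqP desc] | [rows cols]].
  have step (c : cell) : c \in young_diagram -> (0 < c.2)%R -> val_at T (below c) < val_at T c.
    move=> cD pos; have : c \in Descent T by rewrite desc !inE /= cD.
    by rewrite !inE /= => /and3P[].
  split=> c d cD dD.
    move=> cd2; rewrite le_eqVlt => /orP[/eqP cd1 | cd1].
      by rewrite (_ : c = d) //; case: (c) (d) cd1 cd2 => ? ? [? ?] /= -> ->.
    have [n en] : exists n : nat, c.2 = n%:Z%R.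
      by move: cD; rewrite mem_young_diagram => /and3P[_ c2 _]; exists (absz c.2); lia.
    elim: n c d en cD dD cd2 cd1 => [|n IHn] c d en cD dD cd2 cd1.
      apply: hcd => //; first by rewrite /east cd2 eqxx.
      by rewrite mem_young_diagram /=; lia.
    have [c2 d2] : (0 < c.2)%R /\ (0 < d.2)%R by split; lia.
    have bc := young_diagram_below cD c2; have bd := young_diagram_below dD d2.
    have le_b : val_at T (below c) <= val_at T (below d).
      by apply: IHn; rewrite /= ?cd2 //; lia.
    have := h3 c d cD dD _ bc; have := step d dD d2.
    by rewrite /east cd2 eqxx cd1 /inversion3 => ? /(_ isT); lia.
  move=> cd1 cd2.
  have [n en] : exists n : nat, d.2 = (c.2 + n.+1%:Z)%R by exists (absz (d.2 - c.2 - 1)%R); lia.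
  elim: n d dD en cd1 cd2 => [|n IHn] d dD en cd1 cd2.
    have := step d dD; rewrite (_ : below d = c); last first.
      by case: (c) (d) cd1 en => x y [x' y'] /= -> e; rewrite /below /= e; congr pair; lia.
    by apply; move: cD; rewrite mem_young_diagram => /and3P[_ ? _]; lia.
  have d2 : (0 < d.2)%R by move: cD; rewrite mem_young_diagram => /and3P[_ ? _]; lia.
  by apply: ltn_trans (step d dD d2); apply: IHn; rewrite ?young_diagram_below //=; lia.
apply/andP; split.
  apply/inv0P; split=> c d cD dD /andP[/eqP cd2 cd1] bD.
  - have := rows c d cD dD cd2 (ltW cd1); have := cols (below c) c bD cD erefl.
    by rewrite /inversion3 /below /=; lia.
  - case/negP: cD; apply: young_diagram_left dD cd2 _; rewrite (ltW cd1) andbT.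
    by move: bD; rewrite mem_young_diagram => /and3P[].
  exact: rows (ltW cd1).
apply/eqP; apply: cell_fsetP => c; rewrite !inE /=;
  case: (boolP (c \in young_diagram)) => //= cD.
apply/andP/idP => [[] | pos]; first by rewrite mem_young_diagram => /and3P[_ /= ? _] _; lia.
by rewrite young_diagram_below //; split=> //; apply: cols; rewrite ?young_diagram_below //=;
  lia.
Qed.

(** By induction on the row number [r]: an entry [v > r+1] in row [r] would require an entry [v-1]
    further down, where the entries are at most [r]. Strict columns give the lower bound. *)
Lemma row_ballot_tableau (T : filling young_diagram) :
  (forall c : cell, c \in young_diagram -> 0 < val_at T c) -> tableau T -> row_ballot T ->
  forall c : cell, c \in young_diagram -> val_at T c = (absz c.2).+1.
Proof.
move=> pos [_ cols] rb.
suff row_eq n (c : cell) : c \in young_diagram -> absz c.2 < n -> val_at T c = (absz c.2).+1.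
  by move=> c cD; exact: row_eq cD (ltnSn _).
elim: n c => // n IHn c cD; rewrite ltnS => c2n.
have c2 : (0 <= c.2)%R by move: cD; rewrite mem_young_diagram => /and3P[].
apply/eqP; rewrite eqn_leq; apply/andP; split.
  rewrite leqNgt; apply/negP => lt.
  have i0 : 0 < (val_at T c).-1 by lia.
  have := rb _ c.2 i0; rewrite prednK; last by lia.
  have -> : lower_rows T (val_at T c).-1 c.2 = fset0.
    apply: cell_fsetP => d; rewrite in_lower_rows // inE;
      apply/negbTE/negP => /andP[d2 /eqP vd].
    have dD : d \in young_diagram by apply: (@val_at_in _ T); rewrite vd -lt0n.
    have : (0 <= d.2)%R by move: dD; rewrite mem_young_diagram => /and3P[].
    by have := IHn d dD; rewrite vd; lia.
  rewrite cardfs0 leqn0 cardfs_eq0 => /eqP/fsetP/(_ c);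
    rewrite in_lower_rows ?pos // inE eqxx andbT.
  by move/negbT; lia.
have [e0|pos2] := eqVneq c.2 0%R; first by rewrite e0 pos.
have c2' : (0 < c.2)%R by lia.
have bD := young_diagram_below cD c2'; have := cols (below c) c bD cD erefl.
by rewrite IHn //=; lia.
Qed.

End YoungDiagram.

(** * The unique highest weight tableau *)

Section Superstandard.

Variables (la : seq nat) (k : nat).
Lemma young_rows (c : cell) : c \in young_diagram la -> (0 <= c.2 < 0 + (size la)%:Z)%R.
Proof.
rewrite mem_young_diagram => /and3P[_ c2 lt].
have : absz c.2 < size la by rewrite ltnNge; apply/negP => /(nth_default 0) e; rewrite e in lt.
lia.
Qed.

Hypothesis size_la : size la <= k.+1.

Definition superstandard : {ffun young_diagram la -> 'I_k.+1} :=
  [ffun c => inord (absz (val c).2)].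

Lemma superstandardE (c : cell) : c \in young_diagram la ->
  val_at (shift superstandard) c = (absz c.2).+1.
Proof.
move=> cD; rewrite -[c]/(val [` cD]) val_atE !ffunE inordK //=.
by apply: leq_trans size_la; have := young_rows cD; lia.
Qed.

Lemma letters_superstandard : letters superstandard = partition_content k la.
Proof.
apply/ffunP => j; rewrite -count_rw ffunE -card_young_row count_map count_reading.
congr (Posz #|` _|); apply: cell_fsetP => c; rewrite !in_fset !inE.
case: (boolP (c \in young_diagram la)) => //= cD; rewrite superstandardE //.
by have := young_rows cD; lia.
Qed.

Hypothesis la_sorted : sorted geq la.

Lemma superstandard_no_inv : no_inv (upper_cells la) superstandard.
Proof.
rewrite /no_inv; apply/(tableauP la_sorted); split=> c d cD dD; rewrite !superstandardE //.
  by move=> ->.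
have := young_rows cD; have := young_rows dD; lia.
Qed.

Lemma superstandard_row_ballot : row_ballot (shift superstandard).
Proof.
move=> i y i0; apply: leq_card_below => c; rewrite !in_lower_rows // => /andP[cy /eqP vc].
have cD : c \in young_diagram la by apply: (@val_at_in _ (shift superstandard)); rewrite vc.
have := young_rows cD; move: vc; rewrite superstandardE // => -[c2] rows.
have c2' : (0 < c.2)%R by lia.
by rewrite superstandardE ?young_diagram_below //=; lia.
Qed.

(** Thus the alternating sums of the tableau numbers of shape [la] single out the content [la]. *)
Lemma highest_weights_young (c : {ffun 'I_k.+1 -> int}) :
  highest_weights (@no_inv (young_diagram la) (upper_cells la) k) (size la)
    (@row_count (young_diagram la) k 0%R) c = (c == partition_content k la).
Proof.
rewrite /highest_weights -letters_superstandard.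
transitivity #|[pred x | (x == superstandard) && (c == letters superstandard)]|; last first.
  case: eqP => _; last by rewrite eq_card0 // => x; rewrite !inE andbF.
  by rewrite -[RHS](card1 superstandard); apply: eq_card => x; rewrite !inE ?andbT.
apply: eq_card => x; rewrite !inE (content_letters young_rows).
apply/and3P/andP => [[nx /(goodP young_rows) gx /eqP <-] | [/eqP -> /eqP ->]].
  suff -> : x = superstandard by [].
  apply: shift_inj; apply/ffunP => c'; rewrite -!val_atE superstandardE ?fsvalP //.
  apply: (row_ballot_tableau la_sorted) => //; last exact: fsvalP.
  - by move=> d dD; exact: shift_gt0.
  - exact/(tableauP la_sorted).
split=> //; first exact: superstandard_no_inv.
by apply/(goodP young_rows); exact: superstandard_row_ballot.
Qed.

End Superstandard.

Lemma size_partition la : is_partition la -> size la <= sumn la.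
Proof.
case/andP => _; elim: la => //= a la IHla; rewrite inE negb_or eq_sym -lt0n => /andP[a0 /IHla].
lia.
Qed.

(** The zeros of a decreasing sequence form a tail, and the default value is 0 too. *)
Lemma nth_filter_gt0 (s : seq nat) j : sorted geq s ->
  nth 0 (filter (leq 1) s) j = nth 0 s j.
Proof.
elim: s j => //= a s IHs j path_s.
have geq_trans : transitive geq by move=> x y z /= xy xz; exact: leq_trans xz xy.
have := order_path_min geq_trans path_s; case: a path_s => [|a] path_s /= min_s; last first.
  by case: j => //= j; exact: (IHs _ (path_sorted path_s)).
have s0 i : nth 0 s i = 0.
  have [lt|/(nth_default 0)->//] := ltnP i (size s).
  by have /allP/(_ _ (mem_nth 0 lt)) /= := min_s; rewrite leqn0 => /eqP.
by rewrite (IHs j (path_sorted path_s)) s0; case: j => //= j; rewrite s0.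
Qed.

Lemma partition_content_inj k : {in [pred la | is_partition la && (size la <= k.+1)] &,
  injective (partition_content k)}.
Proof.
move=> la mu /andP[/andP[_ la0] la_k] /andP[/andP[_ mu0] mu_k] /ffunP e.
have nth_eq i : nth 0 la i = nth 0 mu i.
  have [ik|ki] := ltnP i k.+1; first by have := e (Ordinal ik); rewrite !ffunE => -[].
  by rewrite !nth_default // (leq_trans _ ki).
have size_le (s t : seq nat) : 0 \notin s -> (forall i,
  nth 0 s i = nth 0 t i) -> size s <= size t.
  move=> s0 st; rewrite leqNgt; apply/negP => lt; case/negP: s0.
  by rewrite -(nth_default 0 (leqnn (size t))) -st mem_nth.
apply: (@eq_from_nth _ 0) => // ; apply/eqP; rewrite eqn_leq !size_le //.
Qed.

(** The last factor is a Kostka number. The difference of the two sides is symmetric in [c], and its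
    alternating sums vanish on weakly decreasing contents. *)
Theorem fillings_expansion (delta gamma : diagram) k (c : {ffun 'I_k.+1 -> int}) :
  #|` delta| <= k.+1 ->
  fillings delta gamma c = \sum_(la <- partitions #|` delta|)
    unjammed_fillings delta gamma k la * fillings (young_diagram la) (upper_cells la) c.
Proof.
move=> dk; set n := #|` delta| in dk *; have [y0 [h rows_delta]] := rows_bounded delta.
have parts la : la \in partitions n -> [/\ is_partition la, sorted geq la & size la <= k.+1].
  rewrite mem_partitions => /andP[pla /eqP sla]; split=> //; first by case/andP: pla.
  by apply: leq_trans (size_partition pla) _; rewrite sla.
pose D (c : {ffun 'I_k.+1 -> int}) := ((fillings delta gamma c)%:Z -
  \sum_(la <- partitions n) (unjammed_fillings delta gamma k la)%:Z *
     (fillings (young_diagram la) (upper_cells la) c)%:Z)%R.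
suff : D c = 0%R.
  move/subr0_eq => e; apply/eqP; rewrite -eqz_nat e; apply/eqP.
  by rewrite (big_morph Posz PoszD (erefl _)); apply: eq_bigr => la _; rewrite PoszM.
have letters_bound (eps0 gam0 : diagram) (c' : {ffun 'I_k.+1 -> int}) :
    fillings eps0 gam0 c' != 0 -> forall j, (0 <= c' j <= (#|` eps0|)%:Z)%R.
  rewrite -lt0n => /card_gt0P[x]; rewrite inE => /andP[_ /eqP <-] j; rewrite ffunE lez_nat /=.
  by rewrite cardfE max_card.
(* A common bound for the multiplicities in all the diagrams involved. *)
apply: (@alternating_eq0 k (n + \sum_(la <- partitions n) #|` young_diagram la|)) =>
  [c' Dc' j|i c'|c' dec].
- have [|z] := eqVneq (fillings delta gamma c') 0; last first.
    by have := letters_bound _ _ _ z j; rewrite -/n; lia.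
  move=> z; have [la la_n lz] : exists2 la,
    la \in partitions n & fillings (young_diagram la) (upper_cells la) c' != 0.
    apply/hasP; apply: contraR Dc' => /hasPn no_la;
      rewrite /D z sub0r oppr_eq0 big_seq big1 // => la la_n.
    by have := no_la la la_n; rewrite negbK => /eqP ->; rewrite mulr0.
  have := letters_bound _ _ _ lz j; rewrite (big_fsetD1 la) //=; lia.
- rewrite /D (fillings_adj _ rows_delta); congr (_ - _)%R.
  by apply: eq_bigr => la _; rewrite (fillings_adj _ (@young_rows la)).
pose perm_content (s : 'S_k.+1) : {ffun 'I_k.+1 -> int} := [ffun j => c' (s j) +
  rho k (s j) - rho k j]%R.
transitivity ((highest_weights (@no_inv delta gamma k) h (@row_count delta k y0) c')%:Z -
   \sum_(la <- partitions n) (unjammed_fillings delta gamma k la)%:Z * (c' == partition_content k la)%:Z)%R.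
  rewrite -(fillings_alternating _ rows_delta) //.
  rewrite (eq_big_seq (fun la => (unjammed_fillings delta gamma k la)%:Z * \sum_(s :
    'S_k.+1) (-1) ^+ s *
     (fillings (young_diagram la) (upper_cells la) (perm_content s))%:Z)%R) => [|la la_n].
    rewrite (eq_bigr (fun la => \sum_(s :
      'S_k.+1) (-1) ^+ s * ((unjammed_fillings delta gamma k la)%:Z *
     (fillings (young_diagram la) (upper_cells la) (perm_content s))%:Z))%R) => [|la _].
      rewrite exchange_big -sumrB; apply: eq_bigr => s _.
      by rewrite -mulr_sumr -mulrBr.
    by rewrite mulr_sumr; apply: eq_bigr => s _; rewrite mulrCA.
  have [pla sla szla] := parts la la_n.
  by rewrite (fillings_alternating _ (@young_rows la)) // highest_weights_young.
have [/hasP[la la_n /eqP ec] | /hasPn no_la] :=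
  boolP (has (fun la => c' == partition_content k la) (partitions n)).
  have [pla sla szla] := parts la la_n.
  rewrite ec (highest_weights_partition _ rows_delta) // (big_fsetD1 la) //= eqxx mulr1.
  rewrite big_seq big1 ?addr0 ?subrr // => mu;
    rewrite in_fsetD1 => /andP[ne /parts[pmu _ szmu]].
  case: eqP => [/partition_content_inj e | _]; last by rewrite mulr0.
  by case/eqP: ne; apply/esym/e; rewrite inE ?pla ?pmu.
rewrite [X in (_ - X)%R]big_seq big1 ?subr0 => [|la /no_la /negPf ->]; last by rewrite mulr0.
congr Posz; apply/eqP; rewrite -leqn0 leqNgt; apply/negP => /card_gt0P[x].
rewrite inE (content_letters rows_delta) => /and3P[nx gx /eqP cx].
(* The content of a highest weight filling, with its zeros dropped, is a partition of [n], against
   [no_la]. *)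
pose s := mkseq (fun j => absz (c' (inord j))) k.+1.
have c'0 j : (0 <= c' j)%R by rewrite -cx ffunE.
have sorted_s : sorted geq s.
  apply/(sortedP 0) => j; rewrite size_mkseq => jk; rewrite !nth_mkseq ?(ltnW jk) //=.
  have := dec (inord j) (inord j.+1); rewrite !inordK ?(ltnW jk) // => /(_ (leqnSn j)).
  by have := c'0 (inord j); have := c'0 (inord j.+1); lia.
pose la := filter (leq 1) s.
have ec : c' = partition_content k la.
  apply/ffunP => j; rewrite ffunE nth_filter_gt0 // nth_mkseq //= inord_val.
  by have := c'0 j; lia.
suff la_n : la \in partitions n by have := no_la la la_n; rewrite ec eqxx.
have geq_trans : transitive geq by move=> a b d /= ab bd; exact: leq_trans bd ab.
rewrite mem_partitions /is_partition (sorted_filter geq_trans) // mem_filter /=.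
rewrite sumnE big_filter big_mkcond /= big_map (eq_bigr (fun j => absz (c' (inord j)))) =>
  [|j _]; last first.
  by case: (absz _).
rewrite -[iota 0 k.+1]/(index_iota 0 k.+1) big_mkord.
rewrite (eq_bigr (fun j => #|[pred d | x d == j]|)) => [|j _];
  last by rewrite inord_val -cx ffunE.
rewrite /n cardfE -sum1_card (partition_big x predT) //=.
by apply/eqP; apply: eq_bigr => j _; rewrite sum1_card.
Qed.

(** * Standardization *)

Lemma count_codom (D : finType) (R : Type) (f : D -> R) (P : pred R) :
  count P (codom f) = #|[pred d | P (f d)]|.
Proof. by rewrite count_map -size_filter cardE enumT; congr size; rewrite /enum_mem -enumT. Qed.

Section Standardization.

Variable delta : diagram.
Implicit Types (T U : filling delta) (c d p q : delta).

Lemma row_reading_refl : reflexive row_reading.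
Proof. by move=> c; rewrite /row_reading eqxx lexx orbT. Qed.

(** Equal entries are treated as increasing in reading order. *)
Definition same_pattern U T := forall p q, row_reading (val p) (val q) -> p != q ->
  (T q < T p) = (U q < U p).

(** For [c] west of [d], the cells [c], [d], [below c] come in this reading order, and each
    comparison in the statistics asks whether a later entry is smaller than an earlier one, or
    negates this. *)
Lemma same_pattern_inv U T : same_pattern U T -> inv U = inv T /\ Descent U = Descent T.
Proof.
move=> UT; have lt_eq (c d : cell) : c \in delta -> d \in delta -> row_reading c d -> c != d ->
    (val_at T d < val_at T c) = (val_at U d < val_at U c).
  by move=> cD dD cd ne; have := UT [` cD] [` dD] cd ne; rewrite -!val_atE.
have row_below (c : cell) : row_reading c (below c) /\ c != below c.
  by rewrite /row_reading /below /=; split; [lia | rewrite eq_sym below_neq].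
have row_east (c d : cell) : east c d -> row_reading c d /\ c != d.
  move=> cd; split; last by apply: contraTneq cd => ->; rewrite eastF.
  by move: cd; rewrite /row_reading /east; lia.
have row_east_below (c d : cell) : east c d -> row_reading d (below c) /\ d != below c.
  move=> cd; split; first by move: cd; rewrite /row_reading /east /below /=; lia.
  by apply: contraTneq cd => ->; rewrite /east /=; lia.
split.
  apply: inv_ext => c d cD dD cd bD.
  - have [r1 n1] := row_below c; have [r2 n2] := row_east c d cd;
      have [r3 n3] := row_east_below c d cd.
    have := lt_eq _ _ cD bD r1 n1; have := lt_eq _ _ cD dD r2 n2; have := lt_eq _ _ dD bD r3 n3.
    by rewrite /inversion3; lia.
  - by have [r3 n3] := row_east_below c d cd; rewrite lt_eq.
  by have [r2 n2] := row_east c d cd; rewrite lt_eq.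
apply: cell_fsetP => c; rewrite !inE /=; case: (boolP (c \in delta)) => //= cD.
case: (boolP (below c \in delta)) => //= bD.
by have [r1 n1] := row_below c; rewrite lt_eq.
Qed.

Definition rank_le U d c := (U d < U c) || (U d == U c) && row_reading (val d) (val c).

Definition standardize U : filling delta := [ffun c => #|[pred d | rank_le U d c]|].

Lemma rank_le_trans U : transitive (rank_le U).
Proof.
move=> d c e; rewrite /rank_le => /orP[lt1 | /andP[/eqP-> r1]] /orP[lt2 | /andP[/eqP e2 r2]].
- by rewrite (ltn_trans lt1 lt2).
- by rewrite -e2 lt1.
- by rewrite lt2.
by rewrite e2 eqxx (row_reading_trans r1 r2) orbT.
Qed.

Lemma rank_le_total U : total (rank_le U).
Proof.
move=> c d; rewrite /rank_le; case: ltngtP => //= _; exact: row_reading_total.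
Qed.

Lemma rank_le_anti U : antisymmetric (rank_le U).
Proof.
move=> c d; rewrite /rank_le; case: ltngtP => //= _ rr.
by apply/val_inj/row_reading_anti.
Qed.

Lemma standardize_lt U c d : (standardize U c < standardize U d) = ~~ rank_le U d c.
Proof.
have le_std c' d' : rank_le U c' d' -> standardize U c' <= standardize U d'.
  move=> cd; rewrite !ffunE; apply/subset_leq_card/subsetP => e; rewrite !inE => ec.
  exact: rank_le_trans ec cd.
apply/idP/idP => [|dc]; first by apply: contraTN => /le_std; rewrite -leqNgt.
have cd : rank_le U c d by have := rank_le_total U c d; rewrite (negPf dc) orbF.
rewrite !ffunE; apply/proper_card/properP; split.
  by apply/subsetP => e; rewrite !inE => ec; exact: rank_le_trans ec cd.
by exists d; rewrite !inE // /rank_le eqxx row_reading_refl orbT.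
Qed.

Lemma standardize_pattern U : same_pattern U (standardize U).
Proof.
by move=> p q pq ne; rewrite standardize_lt /rank_le pq andbT; case: ltngtP.
Qed.

Lemma standardize_inj U : injective (standardize U).
Proof.
move=> c d e; have := standardize_lt U c d; have := standardize_lt U d c.
by rewrite e ltnn => /esym/negPn cd /esym/negPn dc; apply: (@rank_le_anti U); rewrite cd dc.
Qed.

Lemma standardize_standard U : standard (standardize U).
Proof.
rewrite /standard; have uc : uniq (codom (standardize U)).
  by rewrite map_inj_uniq ?enum_uniq //; exact: standardize_inj.
have [||sz mem_eq] := @uniq_min_size _ _ (iota 1 #|` delta|) uc.
- move=> a /codomP[c ->]; rewrite mem_iota ffunE add1n ltnS cardfE max_card andbT.
  by apply/card_gt0P; exists c; rewrite inE /rank_le eqxx row_reading_refl orbT.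
- by rewrite size_iota size_codom cardfE.
by apply: uniq_perm; rewrite ?iota_uniq.
Qed.

Lemma standard_inj T : standard T -> injective T.
Proof.
move=> sT; apply/injectiveP; rewrite /injectiveb /dinjectiveb -[map _ _]/(codom T).
by rewrite (perm_uniq sT) iota_uniq.
Qed.

Lemma standard_bounds T c : standard T -> 0 < T c <= #|` delta|.
Proof. by move=> sT; have := codom_f T c; rewrite (perm_mem sT) mem_iota add1n ltnS. Qed.

Lemma standard_rank T c : standard T -> T c = #|[pred d | T d <= T c]|.
Proof.
move=> sT; have /andP[c0 cn] := standard_bounds c sT.
transitivity (count (leq^~ (T c)) (codom T)); last first.
  exact: count_codom.
rewrite (seq.permP sT).
rewrite (_ : #|` delta| = T c + (#|` delta| - T c))%N; last by lia.
rewrite iotaD count_cat (_ : count _ (iota 1 (T c)) = T c).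
  rewrite (_ : count _ _ = 0) ?addn0 //; apply/eqP; rewrite -leqn0 leqNgt -has_count.
  by apply/hasPn => i; rewrite mem_iota; lia.
rewrite -[RHS](size_iota 1); apply/eqP; rewrite -all_count; apply/allP => i; rewrite mem_iota;
  lia.
Qed.

(** In a standard filling each entry is the rank of its cell, and the pattern determines the
    ranks. *)
Lemma standardize_uniq U T : standard T -> same_pattern U T -> T = standardize U.
Proof.
move=> sT UT; apply/ffunP => c; rewrite ffunE (standard_rank c sT); apply: eq_card => d;
  rewrite !inE.
have [-> | ne] := eqVneq d c; first by rewrite leqnn /rank_le eqxx row_reading_refl orbT.
have neT : T d != T c by apply: contra ne => /eqP/(standard_inj sT) ->.
rewrite /rank_le; case: (boolP (row_reading (val d) (val c))) => [dc | ndc].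
  by rewrite leqNgt UT // andbT; lia.
have cd : row_reading (val c) (val d) by have := row_reading_total (val c) (val d);
  rewrite (negPf ndc) orbF.
by rewrite andbF orbF leq_eqVlt (negPf neT) /= UT // eq_sym.
Qed.

End Standardization.

(** * Compatible sequences as fillings *)

Section Compatible.

Variables (delta : diagram) (T : filling delta).
Implicit Types (c d p q : delta) (s : seq nat).
Local Notation n := #|` delta|.

Definition compatible s := sorted leq s &&
  all (fun j => (nth 0 s j == nth 0 s j.+1) ==> nth false (signature (rw T)) j) (iota 0 n.-1).

Lemma index_reading_lt c d : c != d ->
  (index (val c) (reading delta) < index (val d) (reading delta)) = row_reading (val c) (val d).
Proof.
move=> ne; have cr : val c \in reading delta by rewrite mem_reading fsvalP.
have dr : val d \in reading delta by rewrite mem_reading fsvalP.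
apply/idP/idP => [|cd].
  exact: (sorted_ltn_index row_reading_trans (reading_sorted delta)).
rewrite ltnNge leq_eqVlt; apply/negP => /orP[/eqP e | lt].
  by case/eqP: ne; apply/val_inj/esym; exact: (index_inj (val c) dr cr e).
have dc := sorted_ltn_index row_reading_trans (reading_sorted delta) _ _ dr cr lt.
by case/eqP: ne; apply/val_inj/row_reading_anti; rewrite cd dc.
Qed.

Hypothesis sT : standard T.

Lemma uniq_rw : uniq (rw T).
Proof.
rewrite map_inj_in_uniq ?reading_uniq // => c d; rewrite !mem_reading => cD dD.
by rewrite -[c]/(val [` cD]) -[d]/(val [` dD]) !val_atE => /(standard_inj sT)/(congr1 val).
Qed.

Lemma index_rw c : index (T c) (rw T) = index (val c) (reading delta).
Proof.
rewrite -val_atE -nth_rw ?fsvalP // index_uniq ?uniq_rw // size_rw.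
exact: index_lt (fsvalP c).
Qed.

Lemma standard_cell j : 0 < j <= n -> exists c, T c = j.
Proof.
by move=> jn; have : j \in codom T by [rewrite (perm_mem sT) mem_iota; lia];
  case/codomP => c ->; exists c.
Qed.

Lemma nth_signature j : j < n.-1 ->
  nth false (signature (rw T)) j = (index j.+1 (rw T) < index j.+2 (rw T)).
Proof. by move=> jn; rewrite (nth_map 0) ?size_iota ?size_rw // nth_iota. Qed.

(** The cell that [T] numbers [j] receives the [j]-th term of [s]; the predecessor appears because
    [s] is indexed from 0, the successor because of [shift]. Along a run of equal terms the
    signature makes the cells follow each other in reading order. *)
Lemma compatible_pattern s (U : filling delta) : size s = n ->
  (forall c, U c = (nth 0 s (T c).-1).+1) -> compatible s <-> same_pattern U T.
Proof.
move=> sz UE; split=> [/andP[sorted_s /allP sig] p q pq ne | UT].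
  have step j : j < n.-1 -> nth 0 s j = nth 0 s j.+1 -> index j.+1 (rw T) < index j.+2 (rw T).
    move=> jn e; have := sig j; rewrite mem_iota add0n jn e eqxx nth_signature // => /(_ isT).
    exact.
  have mono i j : i <= j -> j < n -> nth 0 s i <= nth 0 s j.
    move=> ij jn; apply: (sorted_leq_nth leq_trans leqnn 0 sorted_s); rewrite ?inE ?sz //.
    exact: leq_ltn_trans ij jn.
  have chain i l : (i + l.+1 < n)%N -> nth 0 s i = nth 0 s (i + l.+1)%N ->
      index i.+1 (rw T) < index (i + l.+1).+1 (rw T).
    elim: l => [|l IHl] lt; first by rewrite addn1 in lt *; apply: step; lia.
    have m1 : nth 0 s i <= nth 0 s (i + l.+1) by apply: mono; lia.
    have m2 : nth 0 s (i + l.+1) <= nth 0 s (i + l.+2) by apply: mono; lia.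
    move=> e; apply: (@ltn_trans (index (i + l.+1).+1 (rw T))); first by apply: IHl; lia.
    by rewrite (addnS i l.+1) in lt e m2 *; apply: step; lia.
  have /andP[p0 pn] := standard_bounds p sT; have /andP[q0 qn] := standard_bounds q sT.
  rewrite !UE ltnS; have [lt|ge] := ltnP (T q) (T p); last first.
    by apply/esym/negbTE; rewrite -leqNgt; apply: mono; lia.
  have : nth 0 s (T q).-1 <= nth 0 s (T p).-1 by apply: mono; lia.
  rewrite leq_eqVlt => /orP[/eqP e | ->//]; exfalso.
  have := chain (T q).-1 (T p - T q).-1; rewrite (_ : (T q).-1 + _ = (T p).-1)%N; last by lia.
  rewrite !prednK // => /(_ _ e); rewrite !index_rw index_reading_lt; last by rewrite eq_sym.
  by move=> /(_ pn) qp; case/eqP: ne; apply/val_inj/row_reading_anti; rewrite pq qp.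
(* Conversely, the pattern is tested on cells with consecutive numbers. *)
have cells j : j.+1 < n -> exists c d, [/\ T c = j.+1, T d = j.+2, c != d
    & (nth 0 s j <= nth 0 s j.+1) && ((nth 0 s j == nth 0 s j.+1) ==> row_reading (val c) (val d))].
  move=> jn; have [c Tc] := @standard_cell j.+1 (ltnW jn);
    have [d Td] := @standard_cell j.+2 jn.
  have ne : c != d by apply/eqP => e; move: Td; rewrite -e Tc; lia.
  exists c, d; split=> //.
  case: (boolP (row_reading (val c) (val d))) => [cd | ncd].
    by have := UT c d cd ne; rewrite !UE Tc Td /= implybT; lia.
  have dc : row_reading (val d) (val c) by have := row_reading_total (val c) (val d);
    rewrite (negPf ncd).
  by rewrite eq_sym in ne; have := UT d c dc ne; rewrite !UE Tc Td /= implybF; lia.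
apply/andP; split.
  by apply/(sortedP 0) => j; rewrite sz => /cells[c [d [_ _ _ /andP[]]]].
apply/allP => j; rewrite mem_iota add0n => jn.
have jn' : j.+1 < n by lia.
have [c [d [Tc Td ne /andP[_ /implyP rr]]]] := cells j jn'.
by apply/implyP => /rr; rewrite nth_signature // -Td -Tc !index_rw index_reading_lt.
Qed.

Lemma count_entries s i : size s = n ->
  count_mem i s = #|[pred c | nth 0 s (T c).-1 == i]|.
Proof.
move=> sz; transitivity (count_mem i [seq nth 0 s a.-1 | a <- codom T]).
  rewrite (seq.permP (perm_map _ sT)) -(addn0 1) iotaDl -map_comp.
  by rewrite (eq_map (g := nth 0 s)) // -sz map_nth_iota0 ?take_size.
by rewrite count_map count_codom; apply: eq_card => c; rewrite !inE.
Qed.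

End Compatible.

Section Fundamental.

Variables (delta : diagram) (m : {cmonom nat}) (k : nat).
Hypothesis m_le : forall i, i \in finsupp m -> i <= k.
Local Notation n := #|` delta|.

Definition exponents : {ffun 'I_k.+1 -> int} := [ffun j => Posz (m (val j))].

(** Through [compatible_pattern], the sequences counted by the coefficient become the fillings of
    content [m] with standardization [T]; [m_le] makes their letters fit into ['I_k.+1]. *)
Lemma Fund_fillings (T : filling delta) : standard T ->
  Fund T m = Posz #|[pred x : {ffun delta -> 'I_k.+1} |
    (standardize (shift x) == T) && (letters x == exponents)]|.
Proof.
move=> sT; rewrite /Fund /fundamental.
set A := [set s : n.-tuple (finsupp m) | _].
pose f (s : n.-tuple (finsupp m)) : {ffun delta -> 'I_k.+1} :=
  [ffun c => inord (nth 0 (map val s) (T c).-1)].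
have sz (s : n.-tuple (finsupp m)) : size (map val s) = n by rewrite size_map size_tuple.
have fE (s : n.-tuple (finsupp m)) c : f s c = nth 0 (map val s) (T c).-1 :> nat.
  rewrite ffunE inordK // ltnS; apply: m_le; have /andP[c0 cn] := standard_bounds c sT.
  have : nth 0 (map val s) (T c).-1 \in map val s by apply: mem_nth; rewrite sz; lia.
  by case/mapP => i _ ->; exact: fsvalP.
have inA (s : n.-tuple (finsupp m)) :
  (s \in A) = compatible T (map val s) && (monom (map val s) == m).
  by rewrite inE -andbA.
have patt (s : n.-tuple (finsupp m)) :
  compatible T (map val s) <-> standardize (shift (f s)) = T.
  have UE c : shift (f s) c = (nth 0 (map val s) (T c).-1).+1 by rewrite ffunE fE.
    rewrite (compatible_pattern sT (sz s) UE).
  by split=> [/(standardize_uniq sT)//|<-]; exact: standardize_pattern.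
have cont (s : n.-tuple (finsupp m)) : (monom (map val s) == m) = (letters (f s) == exponents).
  have cnt i : monom (map val s) i = #|[pred c | f s c == i :> nat]|.
    by rewrite monomE (count_entries sT _ (sz s)); apply: eq_card => c; rewrite !inE fE.
  apply/cmP/eqP => [e | /ffunP e i].
    by apply/ffunP => j; rewrite !ffunE -e cnt.
  have [ik|ki] := leqP i k; first by have := e (Ordinal (ik : i < k.+1));
    rewrite !ffunE cnt => -[].
  rewrite cnt [RHS](_ : _ = 0%N); last by apply/eqP; rewrite cmE_eq0; apply/negP => /m_le; lia.
  by apply: eq_card0 => c; rewrite !inE; have := ltn_ord (f s c); lia.
congr Posz; rewrite -(card_in_imset (f := f) (D := A)); last first.
  move=> s t _ _ st; apply/val_inj/(inj_map val_inj); apply: (@eq_from_nth _ 0);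
    first by rewrite !sz.
  move=> j; rewrite sz => jn; have [c Tc] := standard_cell sT (j := j.+1) jn.
  by have := fE s c; rewrite st fE Tc.
apply: eq_card => x; rewrite inE; apply/imsetP/andP => [[s + ->] | [/eqP std_x /eqP let_x]].
  by rewrite inA cont => /andP[/patt -> /eqP ->]; rewrite !eqxx.
have x_supp c : val (x c) \in finsupp m.
  rewrite -cmE_neq0; have /ffunP/(_ (x c)) := let_x; rewrite !ffunE => -[<-].
  by rewrite -lt0n; apply/card_gt0P; exists c; rewrite inE.
have cell_ex (j : 'I_n) : exists c, T c == j.+1.
  by have [c Tc] := standard_cell sT (j := j.+1) (ltn_ord j); exists c; apply/eqP.
(* The inverse map: term [j] is the letter in the cell that [T] numbers [j+1]. *)
pose t : n.-tuple (finsupp m) := [tuple [` x_supp (xchoose (cell_ex j))] | j < n].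
have ft : x = f t.
  apply/ffunP => c; apply/val_inj; rewrite [RHS](fE t c);
    have /andP[c0 cn] := standard_bounds c sT.
  have cn' : (T c).-1 < n by lia.
  rewrite (nth_map [` x_supp c]) ?size_tuple // -[X in nth _ _ X]/(val (Ordinal cn')) -tnth_nth tnth_mktuple /=.
  by congr (val (x _)); apply: (standard_inj sT);
    rewrite (eqP (xchooseP (cell_ex (Ordinal cn')))) prednK.
exists t => //; rewrite inA cont -ft let_x eqxx andbT; apply/patt; by rewrite -ft.
Qed.

(** Each filling is counted exactly at its standardization, which has the same inversions and
    descents. *)
Lemma sum_Fund_fillings (gamma : diagram) :
  (\sum_(T <- SF delta | (inv T == 0%N) && (Descent T == gamma)) Fund T m
    = Posz (fillings delta gamma exponents))%R.
Proof.
rewrite big_seq_cond (eq_bigr (fun T : filling delta => \sum_(x : {ffun delta -> 'I_k.+1} |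
   (standardize (shift x) == T) && (letters x == exponents)) 1)%R) => [|T]; last first.
  by rewrite mem_SF => /andP[sT _]; rewrite Fund_fillings // sumr_const natz.
rewrite -big_seq_cond (exchange_big_dep (fun x => letters x == exponents)) /=;
  last by move=> T x _ /andP[].
rewrite (eq_bigr (fun x => if no_inv gamma x then 1 else 0)%R) => [|x /eqP let_x].
  rewrite -big_mkcondr sumr_const natz /fillings; congr Posz.
  by apply: eq_card => x; rewrite !inE andbC.
have [e1 e2] := same_pattern_inv (@standardize_pattern _ (shift x)).
rewrite (eq_bigl (fun T => (T == standardize (shift x)) && no_inv gamma x)) => [|T]; last first.
  rewrite let_x eqxx andbT [in RHS]eq_sym andbC.
  by case: eqP => //= <-; rewrite /no_inv e1 e2.
case: (no_inv gamma x); last by rewrite big_pred0 // => T; rewrite andbF.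
rewrite (eq_bigl (pred1 (standardize (shift x)))) => [|T]; last by rewrite andbT.
rewrite big_mkcond (big_fsetD1 (standardize (shift x))) ?mem_SF ?standardize_standard //= eqxx.
by rewrite big_seq big1 ?addr0 // => T; rewrite in_fsetD1 => /andP[/negPf ->].
Qed.

End Fundamental.

(** * Schur functions *)

Section Schur.

Variables (la : seq nat) (m : {cmonom nat}) (k : nat).
Hypothesis la_sorted : sorted geq la.
Hypothesis m_le : forall i, i \in finsupp m -> i <= k.

Lemma young_to_cell (p : young la) : ((Posz (val p).2, Posz (val p).1) :
  cell) \in young_diagram la.
Proof. by rewrite mem_young_diagram /= -mem_young -surjective_pairing fsvalP. Qed.

Lemma cell_to_young (c : young_diagram la) : (absz (val c).2, absz (val c).1) \in young la.
Proof. by have := fsvalP c; rewrite mem_young_diagram mem_young => /and3P[]. Qed.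

Definition to_cell p : young_diagram la := [` young_to_cell p].
Definition of_cell c : young la := [` cell_to_young c].

Lemma to_cellK : cancel to_cell of_cell.
Proof. by move=> p; apply/val_inj; rewrite /= -surjective_pairing. Qed.

Lemma of_cellK : cancel of_cell to_cell.
Proof.
move=> c; apply/val_inj => /=; have := fsvalP c; rewrite mem_young_diagram => /and3P[].
by case: (fsval c) => x y /= *; congr pair; lia.
Qed.

Lemma schur_fillings :
  schur la m = Posz (fillings (young_diagram la) (upper_cells la) (exponents m k)).
Proof.
rewrite /schur /fillings; set A := [set T | _].
pose f (T : {ffun young la -> finsupp m}) : {ffun young_diagram la -> 'I_k.+1} :=
  [ffun c => inord (val (T (of_cell c)))].
have fE (T : {ffun young la -> finsupp m}) c : f T c = val (T (of_cell c)) :> nat.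
  by rewrite ffunE inordK // ltnS; apply: m_le; exact: fsvalP.
have fV (T : {ffun young la -> finsupp m}) (c : cell) (cD : c \in young_diagram la) :
    val_at (shift (f T)) c = (val (T (of_cell [` cD]))).+1.
  by rewrite -[c]/(val [` cD]) val_atE ffunE fE.
have tab (T : {ffun young la -> finsupp m}) : semistandard T = no_inv (upper_cells la) (f T).
  apply/idP/idP => [/forallP sT | /(tableauP la_sorted)[rows cols]].
    apply/(tableauP la_sorted); split=> c d cD dD e le; rewrite (fV T c cD) (fV T d dD).
      have /forallP/(_ (of_cell [` dD]))/andP[/implyP row _] := sT (of_cell [` cD]).
      rewrite ltnS; apply: row; rewrite /= e eqxx /=.
      by move: cD dD; rewrite !mem_young_diagram; lia.
    have /forallP/(_ (of_cell [` dD]))/andP[_ /implyP col] := sT (of_cell [` cD]).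
    rewrite ltnS; apply: col; rewrite /= e eqxx /=.
    by move: cD dD; rewrite !mem_young_diagram; lia.
  apply/forallP => p; apply/forallP => q.
  have := rows _ _ (young_to_cell p) (young_to_cell q);
    have := cols _ _ (young_to_cell p) (young_to_cell q).
  rewrite (fV T _ (young_to_cell p)) (fV T _ (young_to_cell q)).
  rewrite -[[` young_to_cell p]]/(to_cell p) -[[` young_to_cell q]]/(to_cell q) !to_cellK /= =>
    col row.
  apply/andP; split; apply/implyP => /andP[/eqP e le].
    by rewrite -ltnS; apply: row; rewrite ?e.
  by rewrite -ltnS; apply: col; rewrite ?e.
have cont (T : {ffun young la -> finsupp m}) :
    (monom [seq val (T p) | p : young la] == m) = (letters (f T) == exponents m k).
  have cnt i : monom [seq val (T p) | p : young la] i = #|[pred c | f T c == i :> nat]|.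
    rewrite monomE [LHS]count_codom; apply: (@eq_card_bij _ _ _ _ to_cell of_cell) => [p|c];
      rewrite !inE.
      by rewrite fE to_cellK.
    by rewrite fE of_cellK.
  apply/cmP/eqP => [e | /ffunP e i].
    by apply/ffunP => j; rewrite !ffunE -e cnt.
  have [ik|ki] := leqP i k; first by have := e (Ordinal (ik : i < k.+1));
    rewrite !ffunE cnt => -[].
  rewrite cnt [RHS](_ : _ = 0%N); last by apply/eqP; rewrite cmE_eq0; apply/negP => /m_le; lia.
  by apply: eq_card0 => c; rewrite !inE; have := ltn_ord (f T c); lia.
congr Posz; rewrite -(card_in_imset (f := f) (D := A)); last first.
  move=> S T _ _ e; apply/ffunP => p; apply/val_inj.
  by rewrite -(to_cellK p) -!fE e.
apply: eq_card => x; rewrite inE; apply/imsetP/andP => [[T + ->] | [x_no_inv /eqP let_x]].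
  by rewrite inE tab cont => /andP[].
have x_supp c : val (x c) \in finsupp m.
  rewrite -cmE_neq0; have /ffunP/(_ (x c)) := let_x; rewrite !ffunE => -[<-].
  by rewrite -lt0n; apply/card_gt0P; exists c; rewrite inE.
have ft : x = f [ffun p => [` x_supp (to_cell p)]].
  by apply/ffunP => c; apply/val_inj; rewrite [RHS]fE ffunE /= of_cellK.
by eexists; last exact: ft; rewrite inE tab cont -ft x_no_inv let_x eqxx.
Qed.

End Schur.

(** * The expansion *)

Lemma fill_rw (delta : diagram) (T : filling delta) : fill delta (rw T) = T.
Proof. by apply/ffunP => c; rewrite ffunE nth_rw ?fsvalP // val_atE. Qed.

(** Letters of these words are at most the number of parts of [la], hence at most [k+1], so every
    word comes from a filling. *)
Lemma unjammed_fillings_Yam (delta gamma : diagram) k la :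
  la \in partitions #|` delta| -> #|` delta| <= k.+1 ->
  \sum_(w <- Yam_diag delta la | (inv_word delta w == 0) && (Descent_word delta w == gamma)) 1
  = unjammed_fillings delta gamma k la.
Proof.
rewrite mem_partitions => /andP[pla /eqP sla] dk.
rewrite sum1_count -size_filter /unjammed_fillings cardE.
set A := [pred x : {ffun delta -> 'I_k.+1} | _].
rewrite -(size_map (fun x => rw (shift x))); apply/perm_size/uniq_perm.
- by rewrite filter_uniq ?fset_uniq.
- rewrite map_inj_uniq ?enum_uniq // => x y e; apply: (@shift_inj delta k).
  by rewrite -(fill_rw (shift x)) e fill_rw.
move=> w; rewrite mem_filter /Yam_diag in_fset inE mem_Yam //.
apply/idP/mapP => [/andP[/andP[iw Dw] /andP[yw jw]] | [x + ->]]; last first.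
  by rewrite mem_enum inE /inv_word /Descent_word fill_rw => /and3P[/andP[-> ->] -> ->].
have szw : size w = #|` delta| by rewrite (size_yamanouchi yw).
have w_le a : a \in w -> 0 < a <= k.+1.
  case/and3P: yw => /allP w_in _ _ /w_in /andP[-> /leq_trans]; apply.
  by rewrite (leq_trans (size_partition pla)) // sla.
pose x : {ffun delta -> 'I_k.+1} := [ffun c => inord (fill delta w c).-1].
have xw : shift x = fill delta w.
  apply/ffunP => c; rewrite ffunE ffunE; have /w_le : fill delta w c \in w.
    by rewrite ffunE mem_nth // szw index_lt ?fsvalP.
  by case/andP => c0 ck; rewrite inordK prednK.
exists x; last by rewrite xw rw_fill.
by rewrite mem_enum inE /no_inv xw rw_fill // yw jw -/(inv_word delta w) iw -/(Descent_word delta w) Dw.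
Qed.

Theorem Rseries_expansion (gamma delta : diagram) (m : {cmonom nat}) :
  (Rseries gamma delta m = \sum_(la <- partitions #|` delta|)
       \sum_(w <- Yam_diag delta la |
             (inv_word delta w == 0%N) && (Descent_word delta w == gamma))
         schur la m)%R.
Proof.
(* Large enough for all partitions of the number of cells and for all variables in [m]. *)
pose k := (#|` delta| + \sum_(i <- finsupp m) i)%N.
have m_le i : i \in finsupp m -> i <= k.
  by move=> im; rewrite /k (big_fsetD1 i) //=; lia.
have dk : #|` delta| <= k.+1 by rewrite /k; lia.
rewrite /Rseries (sum_Fund_fillings _ m_le) (fillings_expansion _ _ dk).
rewrite (big_morph Posz PoszD (erefl _)) !big_seq; apply: eq_bigr => la la_n.
have la_sorted : sorted geq la by move: la_n; rewrite mem_partitions => /andP[/andP[]].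
rewrite (schur_fillings la_sorted m_le) -(unjammed_fillings_Yam _ la_n dk).
by rewrite PoszM sum1_count big_const_seq iter_addr_0 -mulr_natl natz.
Qed.

Lemma Descent_sub (delta : diagram) (T : filling delta) : Descent T \in fpowerset delta.
Proof. by rewrite fpowersetE; apply/fsubsetP => c; rewrite !inE => /andP[]. Qed.

(** Used with [maj], which depends on a filling only through its descent set; this reduces the first
    expansion to the second one. *)
Lemma sum_by_descents (I : Type) (r : seq I) (P : pred I) (delta : diagram)
    (D : I -> diagram) (M : diagram -> nat) (F : I -> int) :
  (forall i, D i \in fpowerset delta) ->
  (\sum_(i <- r | P i) 'X^(M (D i)) * (F i)%:P =
   \sum_(g <- fpowerset delta) 'X^(M g) * (\sum_(i <- r | P i && (D i == g)) F i)%:P)%R.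
Proof.
move=> sub; rewrite (eq_bigr (fun g =>
  \sum_(i <- r | P i) if D i == g then 'X^(M g) * (F i)%:P else 0)%R).
  rewrite exchange_big /=; apply: eq_bigr => i _; rewrite (big_fsetD1 (D i)) //= eqxx.
  rewrite big_seq big1 ?addr0 // => g; rewrite in_fsetD1 => /andP[ne _].
  by rewrite eq_sym (negPf ne).
by move=> g _; rewrite -big_mkcondr raddf_sum mulr_sumr.
Qed.

Local Open Scope ring_scope.

Theorem theorem1p1 (gamma delta : {fset int * int}) (sub_gd : gamma `<=` delta) :
  (Htilde delta =1 fun m =>
     \sum_(la <- partitions #|` delta|)
       \sum_(w <- Yam_diag delta la | inv_word delta w == 0%N)
         'X^(maj_word delta w) * (schur la m)%:P)
  /\
  (Rseries gamma delta =1 fun m =>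
     \sum_(la <- partitions #|` delta|)
       \sum_(w <- Yam_diag delta la |
             (inv_word delta w == 0%N) && (Descent_word delta w == gamma))
         schur la m).
Proof.
split=> m; last exact: Rseries_expansion.
pose M (g : diagram) := (\sum_(c <- g) (1 + leg delta c))%N.
rewrite /Htilde (sum_by_descents _ _ M _ (@Descent_sub delta)).
under [RHS]eq_bigr => la _ do
  rewrite (sum_by_descents _ _ M (fun=> schur la m) (fun w =>
    @Descent_sub delta (fill delta w))).
rewrite exchange_big; apply: eq_bigr => g _ /=; rewrite -mulr_sumr.
by rewrite -[X in _ * polyC X = _]/(Rseries g delta m) Rseries_expansion raddf_sum.
Qed.
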